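(* Let $N,M\ge1$, $0\le L\le M$, $\sigma\in\mathfrak S_M$, and let $a_j=q^{\alpha_j}$, $b_i=q^{\beta_i}$, $c_j=q^{\gamma_j}$ ($1\le j\le N$, $1\le i\le M$) satisfy: $a_j/a_k\notin q^{\mathbb Z}$ and $c_j/c_k\notin q^{\mathbb Z}$ for $1\le j\neq k\le N$, and $a_j/(b_{\sigma(i)}\cdots b_{\sigma(M)})\notin q^{\mathbb Z}$, $c_j/(b_{\sigma(i)}\cdots b_{\sigma(M)})\notin q^{\mathbb Z}$ for $1\le j\le N$, $1\le i\le M+1$. Set $$u_0^{L,\sigma}=\prod_{i=L+1}^Mt_{\sigma(i)}^{-\beta_{\sigma(i)}}\cdot\mathcal F_{N,M}^{L}\left(\begin{matrix}\{a_j\},\{b_{\sigma(i)}\}\\ \{c_j\}\end{matrix};\{t_{\sigma(i)}\}\right),$$ and for $1\le k\le N$ $$u_{k,l}^{L,\sigma}=\begin{cases} t_{\sigma(l)}^{1+\sum_{i=l+1}^M\beta_{\sigma(i)}-\gamma_k}\displaystyle\prod_{i=l+1}^Mt_{\sigma(i)}^{-\beta_{\sigma(i)}}\cdot\mathcal G_{N,M}^{L;k,l}\left(\begin{matrix}\{a_j\},\{b_{\sigma(i)}\}\\ \{c_j\}\end{matrix};\{t_{\sigma(i)}\}\right), & 1\le l\le L,\\[2mm] t_{\sigma(l)}^{-\alpha_k+\sum_{i=l+1}^M\beta_{\sigma(i)}}\displaystyle\prod_{i=l+1}^Mt_{\sigma(i)}^{-\beta_{\sigma(i)}}\cdot\mathcal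 F_{N,M}^{L;k,l}\left(\begin{matrix}\{a_j\},\{b_{\sigma(i)}\}\\ \{c_j\}\end{matrix};\{t_{\sigma(i)}\}\right), & L+1\le l\le M.\end{cases}$$ Then $\bm u^{L,\sigma}={}^{\rm T}\big(u_0^{L,\sigma},u_{1,1}^{L,\sigma},\dots,u_{1,M}^{L,\sigma},u_{2,1}^{L,\sigma},\dots,u_{N,M}^{L,\sigma}\big)$ is a fundamental solution of the $q$-difference system $E_{N,M}$ in the region $$D^{L,\sigma}=\Big\{|t_{\sigma(i)}|<1\ (1\le i\le L),\ \Big|\prod_{j=1}^N\frac{c_j}{a_j}\cdot\frac{q}{b_{\sigma(i)}t_{\sigma(i)}}\Big|<1\ (L+1\le i\le M),\ \Big|\frac{qt_{\sigma(i)}}{b_{\sigma(j)}t_{\sigma(j)}}\Big|<1\ (1\le i<j\le M)\Big\}.$$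
   Context: Fix $q\in\mathbb C$, $0<|q|<1$, and a value of $\log q$. $(a)_\infty=\prod_{k\ge0}(1-aq^k)$, $(a)_m=(a)_\infty/(aq^m)_\infty$ for $m\in\mathbb Z$; $q^{\mathbb Z}=\{q^n:n\in\mathbb Z\}$. A fraction $abc/defg$ means $(abc)/(defg)$; empty products are $1$, empty sums $0$ (so $b_i\cdots b_M=1$ for $i=M+1$). For $m=(m_1,\dots,m_M)$, $0\le l\le M$: $m(l)=\sum_{i=1}^lm_i-\sum_{i=l+1}^Mm_i$. Functions of $t=(t_1,\dots,t_M)$, $t_i\ne0$, are regarded as functions of $\log t_i$, with $t_i^\delta=e^{\delta\log t_i}$. $T_s$ is the $q$-shift $t_s\mapsto qt_s$ ($\log t_s\mapsto\log t_s+\log q$), so that $T_st_s^\delta=q^\delta t_s^\delta$, and $T=T_1\cdots T_M$. $E_{N,M}$ is the system for an unknown function $f$: $$\Big\{t_s\prod_{j=1}^N(1-a_jT)\cdot(1-b_sT_s)-\prod_{j=1}^N(1-c_jq^{-1}T)\cdot(1-T_s)\Big\}f=0\quad(1\le s\le M),$$ $$\{t_r(1-b_rT_r)(1-T_s)-t_s(1-b_sT_s)(1-T_r)\}f=0\quad(1\le r<s\le M).$$ It is known that its rank is $NM+1$. A fundamental solution is a vector of $NM+1$ solutions of the system which are linearly independent over the pseudo-constants $K=\{C(t):\ T_iC(t)=C(t)\text{ for all }i\}$. Series: for $0\le L\le M$, $1\le k\le N$, $$\mathcal F^{L}_{N,M}\left(\begin{matrix}\{a_j\},\{b_i\}\\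 \{c_j\}\end{matrix};\{t_i\}\right)=\sum_{m_1,\dots,m_M\ge0}\prod_{j=1}^N\frac{(a_j/b_{L+1}\cdots b_M)_{m(L)}}{(c_j/b_{L+1}\cdots b_M)_{m(L)}}\prod_{i=1}^M\frac{(b_i)_{m_i}}{(q)_{m_i}}\prod_{i=1}^Lt_i^{m_i}\prod_{i=L+1}^M\Big(\frac q{b_it_i}\Big)^{m_i};$$ for $L+1\le l\le M$, $$\mathcal F^{L;k,l}_{N,M}=\sum_{m_1,\dots,m_M\ge0}\prod_{j=1}^N\frac{(qa_k/c_j)_{m_{L+1}}}{(qa_k/a_j)_{m_{L+1}}}\prod_{i=1}^L\frac{(b_i)_{m_i}}{(q)_{m_i}}\prod_{i=L+1}^{l-1}\frac{(b_i)_{m_{i+1}}}{(q)_{m_{i+1}}}\prod_{i=l+1}^M\frac{(b_i)_{m_i}}{(q)_{m_i}}\cdot\frac{(a_k/b_{l+1}\cdots b_M)_{m(l)}}{(qa_k/b_l\cdots b_M)_{m(l)}}$$ $$\times\prod_{i=1}^L\Big(\frac{qt_i}{b_lt_l}\Big)^{m_i}\prod_{i=L+1}^{l-1}\Big(\frac{qt_i}{b_lt_l}\Big)^{m_{i+1}}\prod_{i=l+1}^M\Big(\frac{b_lt_l}{b_it_i}\Big)^{m_i}\Big(\prod_{j=1}^N\frac{c_j}{a_j}\cdot\frac q{b_lt_l}\Big)^{m_{L+1}};$$ for $1\le l\le L$, $$\mathcal G^{L;k,l}_{N,M}=\sum_{m_1,\dots,m_M\ge0}\prod_{j=1}^N\frac{(qa_j/c_k)_{m_L}}{(qc_j/c_k)_{m_L}}\prod_{i=1}^{l-1}\frac{(b_i)_{m_i}}{(q)_{m_i}}\prod_{i=l+1}^{L}\frac{(b_i)_{m_{i-1}}}{(q)_{m_{i-1}}}\prod_{i=L+1}^M\frac{(b_i)_{m_i}}{(q)_{m_i}}\cdot\frac{(c_k/qb_{l+1}\cdots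 b_M)_{m(l-1)}}{(c_k/b_l\cdots b_M)_{m(l-1)}}$$ $$\times\prod_{i=1}^{l-1}\Big(\frac{qt_i}{b_lt_l}\Big)^{m_i}\prod_{i=l+1}^{L}\Big(\frac{b_lt_l}{b_it_i}\Big)^{m_{i-1}}\prod_{i=L+1}^M\Big(\frac{b_lt_l}{b_it_i}\Big)^{m_i}\Big(\frac{b_lt_l}q\Big)^{m_L}$$ (the last two with the same arguments as the first). The equations are understood at points $t$ for which all shifted points occurring in them lie in the region of convergence. *)

(* Defs.v *)
(* Complex numbers are R[i] over a MathComp-Analysis realType R. *)
From HB Require Import structures.
From mathcomp Require Import all_boot all_order all_fingroup all_algebra.
From mathcomp Require Import all_classical all_reals all_analysis.
From mathcomp Require Import complex.

Set Implicit Arguments.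
Unset Strict Implicit.
Unset Printing Implicit Defensive.

Import Order.TTheory GRing.Theory Num.Theory numFieldNormedType.Exports.

Local Open Scope ring_scope.
Local Open Scope classical_set_scope.
Local Open Scope complex_scope.

Definition cexp {R : realType} (z : R[i]) : R[i] :=
  (expR (complex.Re z))%:C * (cos (complex.Im z) +i* sin (complex.Im z)).

Definition qZ {R : realType} (q : R[i]) : set R[i] := range (fun n : int => q ^ n).

Section QPochhammer.
Variables (K : numFieldType) (q : K).

(* The quotient (a)_oo / (a q^m)_oo with its common factors cancelled: this
   keeps its usual value when both infinite products vanish, e.g. (q^-n)_m for
   0 <= m <= n. The two lemmas below relate it to the infinite products. *)
Definition qpoch (a : K) (m : int) : K :=
  match m with
  | Posz n => \prod_(0 <= k < n) (1 - a * q ^+ k)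
  | Negz n => (\prod_(0 <= k < n.+1) (1 - a / q ^+ k.+1))^-1
  end.

Definition is_qpoch_inf (a l : K) : Prop :=
  (fun n : nat => \prod_(0 <= k < n) (1 - a * q ^+ k) : K) @ \oo
    --> l.

Lemma qpoch_nat_inf (a l : K) (n : nat) :
  is_qpoch_inf (a * q ^+ n) l -> is_qpoch_inf a (qpoch a n%:Z * l).
Proof.
move=> al; rewrite /is_qpoch_inf -(cvg_shiftn n).
suff -> : (fun m : nat => \prod_(0 <= k < m + n) (1 - a * q ^+ k)) =
    (fun m => qpoch a n%:Z * \prod_(0 <= k < m) (1 - a * q ^+ n * q ^+ k)).
  exact: cvgMl_tmp.
apply/funext => m; rewrite (@big_cat_nat _ _ _ n) ?leq_addl //=.
congr (_ * _); rewrite -{1}[n]add0n big_addn addnK.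
by apply: eq_bigr => k _; rewrite addnC exprD mulrA.
Qed.

Lemma qpoch_neg_inf (a l : K) (n : nat) : q != 0 ->
  is_qpoch_inf a l -> is_qpoch_inf (a / q ^+ n) (l / qpoch a (- n%:Z)).
Proof.
move=> q0 al.
have -> : l / qpoch a (- n%:Z) = qpoch (a / q ^+ n) n%:Z * l.
  rewrite mulrC; congr (_ * _); case: n => [|n].
    by rewrite oppr0 /= !big_nil invr1.
  rewrite /= invrK big_nat_rev /= add0n; apply: eq_big_nat => k /andP[_ kn].
  have -> : q ^+ n.+1 = q ^+ (n.+1 - k.+1).+1 * q ^+ k.
    by rewrite -exprD addSn subSS subnK.
  by rewrite invfM -!mulrA mulVf ?mulr1 // expf_neq0.
by apply: qpoch_nat_inf; rewrite divfK // expf_neq0.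
Qed.

End QPochhammer.

(* Limit of the partial sums over the cubes {0, ..., n-1}^M. *)
Definition multisum {K : numFieldType} {M : nat} (f : M.-tuple nat -> K) : K :=
  lim ((fun n : nat => \sum_(m : M.-tuple 'I_n) f (map_tuple val m)) @ \oo).

Definition abs_summable {R : realType} {M : nat} (f : M.-tuple nat -> R[i]) :
    Prop :=
  summable [set: M.-tuple nat] (fun m => (Normc.normc (f m))%:E).

(* Families are indexed from 0: the 1-based index i is the ordinal
   i-1, and the i-th summation variable of m is nth 0 m (i-1). A count l of
   leading indices (as in m(l), or the cut L) is the same number. *)
Section Series.
Variables (R : realType) (q : R[i]) (N M : nat).
Variables (a : 'I_N -> R[i]) (b : 'I_M -> R[i]) (c : 'I_N -> R[i]).
Variable (t : 'I_M -> R[i]).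

Definition tailprod (l : nat) : R[i] := \prod_(i < M | (l <= i)%N) b i.

Definition msplit (m : M.-tuple nat) (l : nat) : int :=
  \sum_(i < M | (i < l)%N) (nth 0%N m i)%:Z
  - \sum_(i < M | (l <= i)%N) (nth 0%N m i)%:Z.

(* (b_i)_n / (q)_n *)
Definition bfac (i : 'I_M) (n : nat) : R[i] := qpoch q (b i) n / qpoch q q n.

Definition F0_term (L : nat) (m : M.-tuple nat) : R[i] :=
  \prod_(j < N) (qpoch q (a j / tailprod L) (msplit m L)
                 / qpoch q (c j / tailprod L) (msplit m L))
  * \prod_(i < M) bfac i (nth 0%N m i)
  * \prod_(i < M | (i < L)%N) t i ^+ nth 0%N m i
  * \prod_(i < M | (L <= i)%N) (q / (b i * t i)) ^+ nth 0%N m i.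

(* Meaningful for L <= l (0-based l): then nth 0 m L is an entry of m. *)
Definition F_term (L : nat) (k : 'I_N) (l : 'I_M) (m : M.-tuple nat) : R[i] :=
  \prod_(j < N) (qpoch q (q * a k / c j) (nth 0%N m L)
                 / qpoch q (q * a k / a j) (nth 0%N m L))
  * \prod_(i < M | (i < L)%N) bfac i (nth 0%N m i)
  * \prod_(i < M | (L <= i < l)%N) bfac i (nth 0%N m i.+1)
  * \prod_(i < M | (l < i)%N) bfac i (nth 0%N m i)
  * (qpoch q (a k / tailprod l.+1) (msplit m l.+1)
     / qpoch q (q * a k / tailprod l) (msplit m l.+1))
  * \prod_(i < M | (i < L)%N) (q * t i / (b l * t l)) ^+ nth 0%N m i
  * \prod_(i < M | (L <= i < l)%N) (q * t i / (b l * t l)) ^+ nth 0%N m i.+1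
  * \prod_(i < M | (l < i)%N) (b l * t l / (b i * t i)) ^+ nth 0%N m i
  * (\prod_(j < N) (c j / a j) * (q / (b l * t l))) ^+ nth 0%N m L.

(* Meaningful for l < L (0-based l). *)
Definition G_term (L : nat) (k : 'I_N) (l : 'I_M) (m : M.-tuple nat) : R[i] :=
  \prod_(j < N) (qpoch q (q * a j / c k) (nth 0%N m L.-1)
                 / qpoch q (q * c j / c k) (nth 0%N m L.-1))
  * \prod_(i < M | (i < l)%N) bfac i (nth 0%N m i)
  * \prod_(i < M | (l < i < L)%N) bfac i (nth 0%N m i.-1)
  * \prod_(i < M | (L <= i)%N) bfac i (nth 0%N m i)
  * (qpoch q (c k / (q * tailprod l.+1)) (msplit m l)
     / qpoch q (c k / tailprod l) (msplit m l))
  * \prod_(i < M | (i < l)%N) (q * t i / (b l * t l)) ^+ nth 0%N m i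
  * \prod_(i < M | (l < i < L)%N) (b l * t l / (b i * t i)) ^+ nth 0%N m i.-1
  * \prod_(i < M | (L <= i)%N) (b l * t l / (b i * t i)) ^+ nth 0%N m i
  * (b l * t l / q) ^+ nth 0%N m L.-1.

End Series.

(* Functions of t are functions of x = (log t_1, ..., log t_M). *)
Section System.
Variables (R : realType) (lq : R[i]) (N M : nat).

Definition logpt := 'I_M -> R[i].
Definition logfun := logpt -> R[i].

Definition shift1 (s : 'I_M) (x : logpt) : logpt :=
  fun i => if i == s then x i + lq else x i.
Definition shiftall (x : logpt) : logpt := fun i => x i + lq.

Definition Tq (s : 'I_M) (f : logfun) : logfun := fun x => f (shift1 s x).
Definition Tall (f : logfun) : logfun := fun x => f (shiftall x).

(* The operator 1 - a U. *)
Definition one_sub (a : R[i]) (U : logfun -> logfun) (f : logfun) : logfun :=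
  fun x => f x - a * U f x.

(* \prod_j (1 - a_j T) *)
Definition prod_one_sub (a : 'I_N -> R[i]) : logfun -> logfun :=
  \big[(fun U V f => U (V f))/id]_(j < N) one_sub (a j) Tall.

Variables (q : R[i]) (a : 'I_N -> R[i]) (b : 'I_M -> R[i]) (c : 'I_N -> R[i]).

Definition eq_diag (f : logfun) (s : 'I_M) (x : logpt) : Prop :=
  cexp (x s) * prod_one_sub a (one_sub (b s) (Tq s) f) x
  - prod_one_sub (fun j => c j / q) (one_sub 1 (Tq s) f) x = 0.

Definition eq_pair (f : logfun) (r s : 'I_M) (x : logpt) : Prop :=
  cexp (x r) * one_sub (b r) (Tq r) (one_sub 1 (Tq s) f) x
  - cexp (x s) * one_sub (b s) (Tq s) (one_sub 1 (Tq r) f) x = 0.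

(* Each equation is imposed wherever all shifted points in it lie in D. *)
Definition solution_on (D : set logpt) (f : logfun) : Prop :=
  (forall (s : 'I_M) (x : logpt),
     (forall n : nat, (n <= N)%N ->
        D (iter n shiftall x) /\ D (iter n shiftall (shift1 s x))) ->
     eq_diag f s x)
  /\
  (forall (r s : 'I_M) (x : logpt), (r < s)%N ->
     D x -> D (shift1 r x) -> D (shift1 s x) -> D (shift1 r (shift1 s x)) ->
     eq_pair f r s x).

Definition pseudo_constant (C : logfun) : Prop := forall i : 'I_M, Tq i C = C.

Definition independent_on (D : set logpt) (n : nat) (u : 'cV[logfun]_n) : Prop :=
  forall C : 'I_n -> logfun, (forall p, pseudo_constant (C p)) ->
    (forall x, D x -> \sum_(p < n) C p x * u p 0 x = 0) ->
    forall p x, C p x = 0.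

Definition fundamental_solution_on (D : set logpt) (u : 'cV[logfun]_(1 + N * M)) :
    Prop :=
  (forall p, solution_on D (u p 0)) /\ independent_on D u.

End System.

Section LocalSolutions.
Variables (R : realType) (q : R[i]) (N M : nat).
Variables (alpha : 'I_N -> R[i]) (beta : 'I_M -> R[i]) (gamma : 'I_N -> R[i]).
Variables (a : 'I_N -> R[i]) (b : 'I_M -> R[i]) (c : 'I_N -> R[i]).
Variables (L : nat) (sigma : 'S_M).

Definition u0_term (x : logpt R M) : M.-tuple nat -> R[i] :=
  F0_term q a (fun i => b (sigma i)) c (fun i => cexp (x (sigma i))) L.

Definition ukl_term (k : 'I_N) (l : 'I_M) (x : logpt R M) : M.-tuple nat -> R[i] :=
  if (l < L)%N
  then G_term q a (fun i => b (sigma i)) c (fun i => cexp (x (sigma i))) L k l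
  else F_term q a (fun i => b (sigma i)) c (fun i => cexp (x (sigma i))) L k l.

Definition u0 : logfun R M := fun x =>
  \prod_(i < M | (L <= i)%N) cexp (- beta (sigma i) * x (sigma i))
  * multisum (u0_term x).

Definition ukl (k : 'I_N) (l : 'I_M) : logfun R M := fun x =>
  cexp ((if (l < L)%N
         then 1 + \sum_(i < M | (l < i)%N) beta (sigma i) - gamma k
         else - alpha k + \sum_(i < M | (l < i)%N) beta (sigma i))
        * x (sigma l))
  * \prod_(i < M | (l < i)%N) cexp (- beta (sigma i) * x (sigma i))
  * multisum (ukl_term k l x).

(* (u_0, u_{1,1}, ..., u_{1,M}, u_{2,1}, ..., u_{N,M})^T *)
Definition uvec : 'cV[logfun R M]_(1 + N * M) :=
  (row_mx (const_mx u0) (mxvec (\matrix_(k < N, l < M) ukl k l)))^T.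

Definition region : set (logpt R M) := [set x |
  [/\ forall i : 'I_M, (i < L)%N -> `|cexp (x (sigma i))| < 1,
      forall i : 'I_M, (L <= i)%N ->
        `|\prod_(j < N) (c j / a j) * (q / (b (sigma i) * cexp (x (sigma i))))| < 1
    & forall i j : 'I_M, (i < j)%N ->
        `|q * cexp (x (sigma i)) / (b (sigma j) * cexp (x (sigma j)))| < 1]].

Definition series_converge_on (D : set (logpt R M)) : Prop :=
  forall x, D x -> abs_summable (u0_term x) /\
    forall (k : 'I_N) (l : 'I_M), abs_summable (ukl_term k l x).

End LocalSolutions.

(* Main.v *)
(* Every solution u is, up to a prefactor, a Laurent series
     sum_{nu in Z^M} Phi(|nu|) psi_1(nu_1) ... psi_M(nu_M) t^nu,   |nu| = nu_1 + ... + nu_M,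
   and E_{N,M} only asks Phi and each psi_i to satisfy a first order recurrence.
   Among the M + 1 coordinates nu_1, ..., nu_M, -|nu|, which sum to zero, exactly
   one carries a two-sided factor: |nu| for u_0 and nu_l for u_{k,l}; the others
   are one-sided, and the summation variables m_i of the paper are their absolute
   values. Convergence reduces to geometric series because
   (x)_n / (y)_n = O(1) for n >= 0 and O(|y/x|^-n) for n < 0.

   For the independence over pseudo-constants, the shifts that scale t_1, ..., t_l
   by q (l <= L) or t_l, ..., t_M by 1/q (l > L) preserve the region. Along their
   iterates u is a character times a convergent power series in the powers of q,
   and any two of the characters differ modulo q^Z in some direction. Products of
   operators S_l - z q^j annihilate the first terms of all the solutions but one,
   whose leading coefficient must then vanish. *)
Require Import Defs.
From HB Require Import structures.
From mathcomp Require Import all_boot all_order all_fingroup all_algebra.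
From mathcomp Require Import all_classical all_reals all_analysis.
From mathcomp Require Import complex.
From mathcomp Require Import ring lra zify.

Set Implicit Arguments.
Unset Strict Implicit.
Unset Printing Implicit Defensive.

Import Order.TTheory GRing.Theory Num.Theory numFieldNormedType.Exports.
Local Open Scope ring_scope.
Local Open Scope classical_set_scope.
Local Open Scope complex_scope.

(** * Unordered sums *)

(** Pseudo-constants carry no regularity: all that is known is that they are constant on the orbits
    of the integer q-shifts. The independence argument is therefore confined to a single orbit, on
    which they become plain numbers. The equations are compared coefficient by coefficient on Z^M,
    where multiplication by t_s is a translation, whereas [multisum] is a limit over cubes of the
    variables m_i. Unordered sums are the common ground: they survive reindexing and translation.
    One-sided factors are extended by zero to all of Z, and the recurrences are written without
    division, so that they persist across the edge of the support, where a coefficient of the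
    recurrence vanishes. The non-resonance hypotheses act twice: they keep the denominators of the
    series away from zero, and they separate the characters modulo q^Z. *)

Notation nm := Normc.normc.

Section Modulus.
Variable R : realType.
Implicit Types x y : R[i].

Lemma nmD x y : nm (x + y) <= nm x + nm y. Proof. exact: le_normcD. Qed.
Lemma nmN x : nm (- x) = nm x. Proof. exact: normcN. Qed.
Lemma nmM x y : nm (x * y) = nm x * nm y. Proof. exact: Normc.normcM. Qed.
Lemma nm_ge0 x : 0 <= nm x. Proof. by case: x => u v; exact: sqrtr_ge0. Qed.
Lemma nm_norm x : (nm x)%:C = `|x|. Proof. by []. Qed.
Lemma nm_real (r : R) : nm r%:C = `|r|.
Proof. by rewrite /nm /= expr0n addr0 sqrtr_sqr. Qed.
Lemma nmX x n : nm (x ^+ n) = nm x ^+ n.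
Proof. by elim: n => [|n IH]; rewrite ?Normc.normc1 // !exprS nmM IH. Qed.
Lemma nm_eq0 x : (nm x == 0) = (x == 0).
Proof.
apply/eqP/eqP => [/Normc.eq0_normc //|->]; exact: Normc.normc0.
Qed.
Lemma nm_prod (I : Type) (r : seq I) (P : pred I) (F : I -> R[i]) :
  nm (\prod_(i <- r | P i) F i) = \prod_(i <- r | P i) nm (F i).
Proof. by elim/big_rec2: _ => [|i y z _ <-]; rewrite ?Normc.normc1 ?nmM. Qed.
Lemma nm_sum (I : Type) (r : seq I) (P : pred I) (F : I -> R[i]) :
  nm (\sum_(i <- r | P i) F i) <= \sum_(i <- r | P i) nm (F i).
Proof.
elim/big_rec2: _ => [|i y z _ IH]; first by rewrite Normc.normc0.
by apply: le_trans (nmD _ _) _; rewrite lerD2l.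
Qed.
Lemma nmV x : nm x^-1 = (nm x)^-1. Proof. exact: Normc.normcV. Qed.
Lemma nm_small0 x : (forall e : R, 0 < e -> nm x < e) -> x = 0.
Proof.
move=> h; apply/eqP; rewrite -nm_eq0 eq_le nm_ge0 andbT leNgt.
by apply/negP => /h; rewrite ltxx.
Qed.

End Modulus.

Section UnorderedSums.
Variable R : realType.

(** Convergence along finite sets directed by inclusion. Unlike a limit over cubes it does not
    depend on how the index set is presented. Only [B] has to be duplicate-free; [A] matters through
    its elements alone. *)
Definition has_sum {T : eqType} (f : T -> R[i]) (s : R[i]) : Prop :=
  forall e : R, 0 < e -> exists A : seq T, forall B : seq T,
    uniq B -> {subset A <= B} -> nm (\sum_(i <- B) f i - s) < e.

Definition bounded_sums {T : eqType} (f : T -> R[i]) : Prop :=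
  exists K : R, forall B : seq T, uniq B -> \sum_(i <- B) nm (f i) <= K.

Section Basic.
Variable T : eqType.
Implicit Types f g : T -> R[i].

Lemma has_sum_unique f s s' : has_sum f s -> has_sum f s' -> s = s'.
Proof.
move=> h h'; apply/eqP; rewrite -subr_eq0; apply/eqP/nm_small0 => e e0.
have e20 : 0 < e / 2 by rewrite divr_gt0.
have [A hA] := h _ e20; have [A' hA'] := h' _ e20.
set B := undup (A ++ A').
have uB : uniq B by exact: undup_uniq.
have := hA B uB; have := hA' B uB.
have -> : s - s' = (\sum_(i <- B) f i - s') - (\sum_(i <- B) f i - s) by ring.
move=> h1 h2; apply: le_lt_trans (nmD _ _) _; rewrite nmN [e]splitr.
by apply: ltrD; [apply: h1|apply: h2] => x xA; rewrite mem_undup mem_cat xA ?orbT.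
Qed.

Lemma has_sumD f g s s' :
  has_sum f s -> has_sum g s' -> has_sum (fun t => f t + g t) (s + s').
Proof.
move=> h h' e e0.
have e20 : 0 < e / 2 by rewrite divr_gt0.
have [A hA] := h _ e20; have [A' hA'] := h' _ e20.
exists (A ++ A') => B uB sB; rewrite big_split /=.
have -> : \sum_(i <- B) f i + \sum_(i <- B) g i - (s + s') =
  (\sum_(i <- B) f i - s) + (\sum_(i <- B) g i - s') by ring.
apply: le_lt_trans (nmD _ _) _; rewrite [e]splitr.
by apply: ltrD; [apply: hA|apply: hA'] => // x xA; apply: sB; rewrite mem_cat xA ?orbT.
Qed.

Lemma has_sumZ c f s : has_sum f s -> has_sum (fun t => c * f t) (c * s).
Proof.
move=> h e e0.
have c0 : 0 < nm c + 1 by rewrite ltr_wpDl ?nm_ge0.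
have [A hA] := h (e / (nm c + 1)) (divr_gt0 e0 c0).
exists A => B uB sB; rewrite -mulr_sumr -mulrBr nmM.
have := hA B uB sB; rewrite ltr_pdivlMr // mulrC => H.
by apply: le_lt_trans H; rewrite ler_wpM2r ?nm_ge0 // lerDl.
Qed.

Lemma has_sumB f g s s' :
  has_sum f s -> has_sum g s' -> has_sum (fun t => f t - g t) (s - s').
Proof.
move=> h /(has_sumZ (-1)) h'; have := has_sumD h h'; rewrite mulN1r.
by congr has_sum; apply/funext => t; rewrite mulN1r.
Qed.

Lemma has_sum_norm_le f s K : has_sum f s ->
  (forall B, uniq B -> \sum_(i <- B) nm (f i) <= K) -> nm s <= K.
Proof.
move=> h hK; apply/ler_addgt0Pr => e e0.
have [A hA] := h e e0.
have uA := undup_uniq A.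
have /(hA _ uA) {}hA : {subset A <= undup A} by move=> x; rewrite mem_undup.
have -> : s = \sum_(i <- undup A) f i - (\sum_(i <- undup A) f i - s) by ring.
apply: le_trans (nmD _ _) _; rewrite nmN; apply: lerD; last exact: ltW.
by apply: le_trans (nm_sum _ _ _) _; apply: hK.
Qed.

Lemma bounded_sums_dom f g (K : R) : bounded_sums f ->
  (forall t, nm (g t) <= K * nm (f t)) -> bounded_sums g.
Proof.
move=> [M hM] hK; exists (`|K| * M) => B uB.
apply: (@le_trans _ _ (\sum_(i <- B) `|K| * nm (f i))).
  apply: ler_sum => i _; apply: le_trans (hK i) _.
  by rewrite ler_wpM2r ?nm_ge0 // ler_norm.
by rewrite -mulr_sumr ler_wpM2l // hM.
Qed.

Let has_sum_nonneg (g : T -> R) K : (forall t, 0 <= g t) ->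
  (forall B, uniq B -> \sum_(i <- B) g i <= K) ->
  exists s, has_sum (fun t => (g t)%:C) s.
Proof.
move=> g0 hK.
pose E : set R := [set x | exists2 B, uniq B & x = \sum_(i <- B) g i].
have supE : has_sup E.
  split; first by exists (\sum_(i <- [::]) g i), [::].
  by exists K => _ [B uB ->]; exact: hK.
exists (sup E)%:C => e e0.
have [_ [A uA ->] hA] := sup_adherent e0 supE.
exists A => B uB sB; rewrite -raddf_sum -rmorphB nm_real.
have AB : \sum_(i <- A) g i <= \sum_(i <- B) g i.
  have pAB : perm_eq [seq i <- B | i \in A] A.
    apply: uniq_perm => //; first exact: filter_uniq.
    by move=> x; rewrite mem_filter andb_idr // => /sB.
  rewrite -(perm_big _ pAB) big_filter big_mkcond /=.
  by apply: ler_sum => i _; case: ifP.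
have Bs : \sum_(i <- B) g i <= sup E by apply: ub_le_sup; [case: supE|exists B].
by rewrite ler0_norm ?subr_le0 //; lra.
Qed.

(** The positive and negative parts of the real and imaginary parts are each dominated by the
    modulus, and a nonnegative family with bounded finite sums has their supremum as its sum. *)
Lemma bounded_has_sum f : bounded_sums f -> exists s, has_sum f s.
Proof.
move=> [K hK].
have Re_le z : `|complex.Re z| <= nm z :> R.
  case: z => u v; rewrite /nm /= -sqrtr_sqr ler_sqrt.
    by rewrite lerDl sqr_ge0.
  by rewrite addr_ge0 ?sqr_ge0.
have Im_le z : `|complex.Im z| <= nm z :> R.
  case: z => u v; rewrite /nm /= -sqrtr_sqr ler_sqrt.
    by rewrite lerDr sqr_ge0.
  by rewrite addr_ge0 ?sqr_ge0.
have dom (h : T -> R) : (forall t, `|h t| <= nm (f t)) ->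
    exists s, has_sum (fun t => (h t)%:C) s.
  move=> hh.
  have [||s hs] := @has_sum_nonneg (fun t => Num.max (h t) 0) K.
  - by move=> t; rewrite le_max lexx orbT.
  - move=> B uB; apply: le_trans (hK B uB); apply: ler_sum => i _.
    by rewrite ge_max nm_ge0 andbT (le_trans _ (hh i)) // ler_norm.
  have [||s' hs'] := @has_sum_nonneg (fun t => Num.max (- h t) 0) K.
  - by move=> t; rewrite le_max lexx orbT.
  - move=> B uB; apply: le_trans (hK B uB); apply: ler_sum => i _.
    by rewrite ge_max nm_ge0 andbT (le_trans _ (hh i)) // -normrN ler_norm.
  exists (s - s'); have := has_sumB hs hs'; congr has_sum; apply/funext => t.
  rewrite -rmorphB; congr (_%:C); case: (lerP 0 (h t)) => h0.
    by rewrite !maxElt; case: ltP; case: ltP => /=; lra.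
  by rewrite !maxElt; case: ltP; case: ltP => /=; lra.
have [s1 h1] := dom _ (fun t => Re_le (f t)).
have [s2 h2] := dom _ (fun t => Im_le (f t)).
exists (s1 + 'i%C * s2); have := has_sumD h1 (has_sumZ 'i%C h2).
by congr has_sum; apply/funext => t; rewrite -complexE.
Qed.

End Basic.

Section Reindex.
Variables (T T' : eqType) (h : T -> T') (h' : T' -> T) (g : T' -> R[i]).
Hypothesis hK : cancel h h'.
Hypothesis gh : forall t', g t' != 0 -> h (h' t') = t'.

Let back (V : nmodType) (G : T' -> V) (B : seq T') :
    (forall t', h (h' t') != t' -> G t' = 0) ->
  \sum_(i <- B) G i =
  \sum_(i <- [seq h' t | t <- B & h (h' t) == t]) G (h i).
Proof.
move=> G0; rewrite big_map big_filter [in RHS]big_mkcond /=.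
by apply: eq_bigr => i _; case: eqP => [->//|/eqP /G0].
Qed.

Let back_uniq (B : seq T') : uniq B ->
  uniq [seq h' t | t <- B & h (h' t) == t].
Proof.
move=> uB; rewrite map_inj_in_uniq ?filter_uniq // => x y.
by rewrite !mem_filter => /andP[/eqP hx _] /andP[/eqP hy _] e; rewrite -hx e.
Qed.

Let g0 t' : h (h' t') != t' -> g t' = 0.
Proof. by apply: contraNeq => /gh ->. Qed.

(** [h] has to be injective with an image that contains the support of [g]; it need not be onto. The
    indices outside the image contribute nothing, so a finite set can be pulled back by discarding
    them. *)
Lemma has_sum_reindex s : has_sum (fun t => g (h t)) s -> has_sum g s.
Proof.
move=> hs e e0; have [A hA] := hs e e0.
exists (map h A) => B uB sB; rewrite (back B g0); apply: hA.
  exact: back_uniq.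
move=> x xA; apply/mapP; exists (h x); last by rewrite hK.
by rewrite mem_filter hK eqxx sB // map_f.
Qed.

Lemma bounded_sums_reindex :
  bounded_sums (fun t => g (h t)) -> bounded_sums g.
Proof.
move=> [K bK]; exists K => B uB.
rewrite (back B) => [|t' /g0 ->]; last exact: Normc.normc0.
exact/bK/back_uniq.
Qed.

End Reindex.

(** Every finite set of indices lies in all sufficiently large cubes. *)
Lemma has_sum_multisum M (f : M.-tuple nat -> R[i]) s :
  has_sum f s -> multisum f = s.
Proof.
move=> hs; apply: cvg_lim => //; apply/cvgrPdist_lt => e.
rewrite ltcE /= => /andP[/eqP e1 e0].
have [A hA] := hs _ e0.
(* This bound exceeds every entry of every tuple in [A]. *)
pose n0 := (\max_(m <- A) \max_(i < M) (tnth m i).+1)%N.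
exists n0 => // n /= n0n; rewrite distrC -nm_norm.
pose B := [seq map_tuple val m | m <- enum {: M.-tuple 'I_n}].
have -> : \sum_(m : M.-tuple 'I_n) f (map_tuple val m) = \sum_(m <- B) f m.
  by rewrite big_map big_enum.
have -> : e = (complex.Re e)%:C by case: (e) e1 => u v /= ->.
rewrite ltcR; apply: hA.
  rewrite map_inj_uniq ?enum_uniq // => x y /(congr1 val) /= xy.
  by apply/val_inj/(inj_map val_inj).
move=> m mA; apply/mapP.
have lt_m i : (tnth m i < n)%N.
  apply: leq_trans n0n; rewrite /n0 (big_rem m) //= leq_max.
  by rewrite (bigD1 i) //= leq_max leqnn.
exists [tuple Ordinal (lt_m i) | i < M]; first by rewrite mem_enum.
by apply: eq_from_tnth => i; rewrite tnth_map tnth_mktuple.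
Qed.

Lemma bounded_abs_summable M (f : M.-tuple nat -> R[i]) :
  bounded_sums f -> abs_summable f.
Proof.
move=> [K hK]; rewrite /abs_summable /summable /esum.
apply: (@le_lt_trans _ _ (K%:E)); last exact: ltry.
apply: ge_ereal_sup => _ [A [fA _] <-].
rewrite fsbig_finite //=; under eq_bigr do rewrite ger0_norm ?nm_ge0 //.
by rewrite sumEFin lee_fin; apply: hK; exact: finmap.fset_uniq.
Qed.

End UnorderedSums.

(** * Geometric bounds *)

Section Geometric.
Variable R : realType.

Lemma geometric_small (r K e : R) : 0 <= r < 1 -> 0 < e ->
  exists n0, forall n, (n0 <= n)%N -> K * r ^+ n < e.
Proof.
move=> /andP[r0 r1] e0.
have /cvg_expr : `|r| < 1 by rewrite ger0_norm.
move=> /cvgrPdist_lt /(_ (e / (`|K| + 1))) [|n0 _ hn].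
  by rewrite divr_gt0 // ltr_wpDl.
exists n0 => n /hn /=; rewrite sub0r normrN normrX (ger0_norm r0).
rewrite ltr_pdivlMr ?ltr_wpDl // => H; apply: le_lt_trans H.
rewrite mulrC ler_wpM2l ?exprn_ge0 //.
by rewrite (le_trans (ler_norm K)) // lerDl.
Qed.

Lemma geometric_sum_le (r : R) n : 0 <= r < 1 ->
  \sum_(k < n) r ^+ k <= (1 - r)^-1.
Proof.
move=> /andP[r0 r1]; have r1' : 0 < 1 - r by rewrite subr_gt0.
rewrite -[leRHS]mul1r ler_pdivlMr // mulrC.
have -> : (1 - r) * \sum_(k < n) r ^+ k = 1 - r ^+ n.
  by rewrite -[RHS]opprB subrX1 -mulNr opprB.
by rewrite gerBl exprn_ge0.
Qed.

(** A finite set of tuples embeds in a box, over which the sum factors into finite geometric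
    sums. *)
Lemma geometric_tuple_sum_le M (s : 'I_M -> R) (B : seq (M.-tuple nat)) :
  (forall i, 0 <= s i < 1) -> uniq B ->
  \sum_(m <- B) \prod_i s i ^+ tnth m i <= \prod_i (1 - s i)^-1.
Proof.
move=> hs uB.
have s0 i : 0 <= s i by case/andP: (hs i).
pose K := (\max_(m <- B) \max_(i < M) tnth m i)%N.
have leK m i : m \in B -> (tnth m i <= K)%N.
  by move=> mB; rewrite /K (big_rem m) //= leq_max (bigD1 i) //= leq_max leqnn.
pose h (m : M.-tuple nat) : {ffun 'I_M -> 'I_K.+1} := [ffun i => inord (tnth m i)].
have -> : \sum_(m <- B) \prod_i s i ^+ tnth m i =
    \sum_(f <- map h B) \prod_i s i ^+ f i.
  rewrite big_map !big_seq; apply: eq_bigr => m mB; apply: eq_bigr => i _.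
  by rewrite /h ffunE inordK // ltnS leK.
have uh : uniq (map h B).
  rewrite map_inj_in_uniq // => m m' mB mB' /ffunP hmm.
  apply: eq_from_tnth => i; have := congr1 val (hmm i).
  by rewrite /h !ffunE /= !inordK // ltnS leK.
have p0 (f : {ffun 'I_M -> 'I_K.+1}) : 0 <= \prod_i s i ^+ f i.
  by apply: prodr_ge0 => i _; rewrite exprn_ge0.
rewrite big_uniq //.
apply: (@le_trans _ _ (\sum_(f : {ffun 'I_M -> 'I_K.+1}) \prod_i s i ^+ f i)).
  by rewrite big_mkcond /=; apply: ler_sum => f _; case: ifP.
rewrite -(bigA_distr_bigA (fun i (k : 'I_K.+1) => s i ^+ k)).
apply: ler_prod => i _; rewrite geometric_sum_le // andbT.
by apply: sumr_ge0 => k _; rewrite exprn_ge0.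
Qed.

End Geometric.

Definition negpart (n : int) : nat := if n is Negz p then p.+1 else 0%N.

Definition signed_sum M (pos : pred 'I_M) (m : M.-tuple nat) : int :=
  \sum_i (if pos i then (tnth m i)%:Z else - (tnth m i)%:Z).

Section Convergence.
Variables (R : realType) (M : nat) (pos : pred 'I_M) (s : 'I_M -> R) (rho : R).
Hypotheses (s0 : forall i, 0 <= s i) (rho0 : 0 <= rho)
  (s_pos : forall i, pos i -> s i < 1)
  (s_neg : forall j, ~~ pos j -> s j * rho < 1)
  (s_mix : forall i j, pos i -> ~~ pos j -> s j * s i < 1).

Let P (m : M.-tuple nat) := (\sum_(i | pos i) tnth m i)%N.
Let N (m : M.-tuple nat) := (\sum_(i | ~~ pos i) tnth m i)%N.

Let signed_sumE m : signed_sum pos m = (P m)%:Z - (N m)%:Z.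
Proof.
rewrite /signed_sum (bigID pos) /= /P /N !(big_morph Posz PoszD (erefl _)).
rewrite -sumrN; congr (_ + _); apply: eq_bigr => i; first by move->.
by move/negPf->.
Qed.

Let exists_split : exists u v : R, [/\ 0 <= u, 0 <= v,
  forall i, pos i -> s i * u < 1, forall j, ~~ pos j -> s j * v < 1 &
  forall m, rho ^+ negpart (signed_sum pos m) <= u ^+ P m * v ^+ N m].
Proof.
(* For lam in [rho, 1], rho^(max(0, N - P)) <= lam^(N - P); lam is chosen above all
   the positive ratios and below the inverses of the negative ones. *)
have [rho1|rho1] := leP 1 rho.
  (* Here max(0, N - P) <= N gives rho^(max(0, N - P)) <= rho^N, so the negative coordinates alone
     can absorb rho. *)
  exists 1, rho; split=> // [i /s_pos|m]; first by rewrite mulr1.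
  rewrite expr1n mul1r ler_weXn2l // signed_sumE.
  by case E: (_ - _) => [k|k] //=; lia.
pose A := \big[Num.max/rho]_(i | pos i) s i.
have [A1 Aj] : A < 1 /\ forall j, ~~ pos j -> s j * A < 1.
  rewrite /A; apply: (big_ind (fun A => A < 1 /\ forall j, ~~ pos j -> s j * A < 1)) => //.
    by move=> x y [x1 hx] [y1 hy]; rewrite maxElt; case: ifP.
  by move=> i hi; split=> [|j hj]; [exact: s_pos|exact: s_mix].
have rhoA : rho <= A by rewrite /A; apply: bigmax_ge_id.
have sA i : pos i -> s i <= A by move=> hi; apply: le_bigmax_cond.
pose S := \big[Num.max/1]_(j | ~~ pos j) s j.
have SA : S * A < 1.
  rewrite /S; apply: (big_ind (fun S => S * A < 1)); rewrite ?mul1r //.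
  by move=> x y hx hy; rewrite maxElt; case: ifP.
have S1 : 1 <= S by rewrite /S; apply: bigmax_ge_id.
have sS j : ~~ pos j -> s j <= S by move=> hj; apply: le_bigmax_cond.
have S0 : 0 < S by exact: lt_le_trans S1.
have AV : A < S^-1 by rewrite -[S^-1]mul1r ltr_pdivlMr // mulrC.
have A0 : 0 <= A by exact: le_trans rhoA.
have SV1 : S^-1 <= 1 by rewrite invf_le1.
pose lam := (A + S^-1) / 2.
have lamA : A < lam by rewrite /lam; lra.
have lam0 : 0 < lam by lra.
have lamS : lam < S^-1 by rewrite /lam; lra.
exists lam^-1, lam; split; rewrite ?invr_ge0 ?ltW //.
- by move=> i /sA si; rewrite ltr_pdivrMr // mul1r (le_lt_trans si).
- move=> j /sS sj; apply: (@le_lt_trans _ _ (S * lam)).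
    by rewrite ler_wpM2r // ltW.
  by rewrite mulrC -ltr_pdivlMr // mul1r.
move=> m; rewrite exprVn mulrC ler_pdivlMr ?exprn_gt0 // signed_sumE.
have [PN|NP] := leqP (N m) (P m).
  rewrite subzn //= mul1r; apply: ler_wiXn2l => //; lra.
have -> : negpart ((P m)%:Z - (N m)%:Z) = (N m - P m)%N.
  case E: (_ - _) => [k|k] /=; lia.
rewrite -[in leRHS](subnK (ltnW NP)) exprD ler_wpM2r //.
  by rewrite exprn_ge0 // ltW.
by apply: lerXn2r; rewrite ?nnegrE ?(ltW lam0) // (le_trans rhoA) // ltW.
Qed.

(** The hypotheses govern the rays to infinity: [s_pos] one positive coordinate, [s_neg] one
    negative coordinate, which also produces powers of rho, and [s_mix] a positive and a negative
    coordinate together, which leave the signed sum unchanged. The split of rho into [u] and [v]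
    turns these joint conditions into one geometric ratio below 1 for each coordinate. *)
Lemma bounded_sums_signed (w : M.-tuple nat -> R[i]) (K : R) :
  (forall m, nm (w m) <=
     K * (rho ^+ negpart (signed_sum pos m) * \prod_i s i ^+ tnth m i)) ->
  bounded_sums w.
Proof.
move=> hw; have [u [v [u0 v0 hu hv huv]]] := exists_split.
pose s' i := s i * (if pos i then u else v).
have hs' i : 0 <= s' i < 1.
  rewrite /s'; case: ifPn => hi; first by rewrite mulr_ge0 ?hu.
  by rewrite mulr_ge0 ?hv.
exists (`|K| * \prod_i (1 - s' i)^-1) => B uB.
apply: le_trans (_ : `|K| * (\sum_(m <- B) \prod_i s' i ^+ tnth m i) <= _); last first.
  by rewrite ler_wpM2l // geometric_tuple_sum_le.
rewrite mulr_sumr; apply: ler_sum => m _; apply: le_trans (hw m) _.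
have pr0 : 0 <= \prod_i s i ^+ tnth m i.
  by apply: prodr_ge0 => i _; rewrite exprn_ge0.
apply: (@le_trans _ _
  (`|K| * (rho ^+ negpart (signed_sum pos m) * \prod_i s i ^+ tnth m i))).
  by rewrite ler_wpM2r ?ler_norm // mulr_ge0 // exprn_ge0.
rewrite ler_wpM2l //.
apply: (@le_trans _ _ (u ^+ P m * v ^+ N m * \prod_i s i ^+ tnth m i)).
  by rewrite ler_wpM2r.
rewrite le_eqVlt; apply/orP; left; apply/eqP.
under [RHS]eq_bigr do rewrite /s' exprMn.
rewrite big_split /= mulrC; congr (_ * _); rewrite [RHS](bigID pos) /= /P /N.
by rewrite -!prodrXr; congr (_ * _); apply: eq_bigr => i;
  [move->|move/negPf->].
Qed.

End Convergence.

(** * q-shifted factorials *)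

Section QPochhammerFacts.
Variables (R : realType) (q : R[i]).
Hypotheses (q0 : q != 0) (q1 : nm q < 1).

Lemma qpoch0 (a : R[i]) : qpoch q a 0 = 1.
Proof. by rewrite /= big_nil. Qed.

(** For n >= 0 a factor is appended; for n < 0 one is removed from an inverted product, and since
    the inverse of 0 is 0 the cancellation needs that factor to be nonzero. *)
Lemma qpochS (a : R[i]) (n : int) : (n < 0 -> 1 - a * q ^ n != 0) ->
  qpoch q a (n + 1) = qpoch q a n * (1 - a * q ^ n).
Proof.
case: n => [n _|n] /=; first by rewrite addn1 big_nat_recr.
move=> /(_ isT); rewrite NegzE -exprnN => h.
case: n h => [|n] h.
  by rewrite addNr /= big_nil big_nat1 mulVf.
have -> : - n.+2%:Z + 1 = Negz n by rewrite NegzE; lia.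
by rewrite /= [in RHS]big_nat_recr //= invfM mulfVK.
Qed.

Lemma qpoch_neq0 (a : R[i]) (n : int) :
  (forall k : int, 1 - a * q ^ k != 0) -> qpoch q a n != 0.
Proof.
move=> h; case: n => n /=; rewrite ?invr_eq0 prodf_seq_neq0; apply/allP => k _ /=.
  exact: (h k).
by have := h (Negz k); rewrite NegzE -exprnN.
Qed.

(** Reflection formula. The last product is q^(n(n+1)/2); it is left as a product because it cancels
    in ratios. *)
Lemma qpochN (a : R[i]) (n : nat) : a != 0 ->
  qpoch q a (- n%:Z) = ((- a) ^+ n * qpoch q (q / a) n)^-1 * \prod_(0 <= k < n) q ^+ k.+1.
Proof.
move=> a0; case: n => [|n]; first by rewrite oppr0 /= !big_nil mul1r invr1 mulr1.
set p := \prod_(_ <= _ < _) _; have p0 : p != 0.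
  by rewrite prodf_seq_neq0; apply/allP => k _; rewrite expf_neq0.
rewrite -NegzE /= -[LHS](mulfVK p0); congr (_ * p); rewrite -invfM; congr (_^-1).
have -> : (- a) ^+ n.+1 = \prod_(0 <= k < n.+1) (- a) by rewrite prodr_const_nat subn0.
rewrite /p -!big_split /=.
apply: eq_bigr => k _; rewrite exprS; field.
by rewrite q0 a0 expf_neq0.
Qed.

Lemma qpoch_ratioN (x y : R[i]) (n : nat) : x != 0 -> y != 0 ->
  qpoch q x (- n%:Z) / qpoch q y (- n%:Z) =
  (y / x) ^+ n * (qpoch q (q / y) n / qpoch q (q / x) n).
Proof.
move=> x0 y0; rewrite !qpochN //.
set p := \prod_(_ <= _ < _) _; have p0 : p != 0.
  by rewrite prodf_seq_neq0; apply/allP => k _; rewrite expf_neq0.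
rewrite !invfM !invrK (exprNn x) (exprNn y) !exprMn !exprVn.
have s0 : (-1) ^+ n != 0 :> R[i] by rewrite signr_eq0.
have [->|] := eqVneq (qpoch q (q / x) n) 0; first by rewrite invr0; ring.
set u := qpoch q (q / x) n; set v := qpoch q _ n => u0.
by field; rewrite s0 u0 !expf_neq0 // p0.
Qed.

(** The values tend to 1, so all but finitely many have modulus at least 1/2, and the remaining ones
    are nonzero. *)
Let lower_bound (y : R[i]) : (forall n : nat, 1 - y * q ^+ n != 0) ->
  exists2 d : R, 0 < d & forall n, d <= nm (1 - y * q ^+ n).
Proof.
move=> h.
have [|//|n0 hn0] := @geometric_small R (nm q) (nm y) 2^-1 _ _.
  by rewrite nm_ge0 q1.
have [d d0 hd] : exists2 d : R, 0 < d & forall n, (n < n0)%N -> d <= nm (1 - y * q ^+ n).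
  elim: n0 {hn0} => [|n0 [d d0 hd]]; first by exists 1.
  exists (Num.min d (nm (1 - y * q ^+ n0))).
    by rewrite lt_min d0 lt_def nm_ge0 nm_eq0 h.
  move=> n; rewrite ltnS leq_eqVlt => /orP[/eqP->|/hd]; first by rewrite ge_min lexx orbT.
  by rewrite ge_min => ->.
exists (Num.min d 2^-1) => [|n]; first by rewrite lt_min d0 invr_gt0 ltr0n.
have [/hd|/hn0] := ltnP n n0; first by rewrite ge_min => ->.
rewrite -nmX -nmM => H; rewrite ge_min; apply/orP; right.
have : 1 <= nm (1 - y * q ^+ n) + nm (y * q ^+ n).
  by rewrite -[leLHS](@Normc.normc1 R) -[in leLHS](subrK (y * q ^+ n) 1) nmD.
lra.
Qed.

Lemma qpoch_ratio_bounded (x y : R[i]) : (forall n : nat, 1 - y * q ^+ n != 0) ->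
  exists K : R, forall n : nat, nm (qpoch q x n / qpoch q y n) <= K.
Proof.
move=> h; have [d d0 hd] := lower_bound h.
pose D := nm (y - x) / d.
have D0 : 0 <= D by rewrite divr_ge0 ?nm_ge0 ?ltW.
(* |1 + z| <= exp |z|, and the arguments form a geometric series. *)
have step n : nm ((1 - x * q ^+ n) / (1 - y * q ^+ n)) <= expR (D * nm q ^+ n).
  apply: le_trans (expR_ge1Dx _).
  have -> : (1 - x * q ^+ n) / (1 - y * q ^+ n) =
      1 + (y - x) * q ^+ n / (1 - y * q ^+ n).
    by have := h n => hn; field.
  apply: le_trans (nmD _ _) _; rewrite Normc.normc1 lerD2l !nmM nmV nmX /D.
  rewrite -!mulrA ler_wpM2l ?nm_ge0 // mulrC ler_wpM2r ?exprn_ge0 ?nm_ge0 //.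
  by rewrite lef_pV2 ?posrE // (lt_le_trans d0).
exists (expR (D * (1 - nm q)^-1)) => n.
apply: (@le_trans _ _ (expR (D * \sum_(k < n) nm q ^+ k))); last first.
  by rewrite ler_expR ler_wpM2l // geometric_sum_le // nm_ge0.
rewrite /= -prodf_div nm_prod mulr_sumr big_mkord expR_sum.
by apply: ler_prod => k _; rewrite nm_ge0 step.
Qed.

(** Negative indices are reflected to positive ones, which costs the geometric factor (y/x)^n and
    replaces the parameters by q/y and q/x. *)
Lemma qpoch_ratio_bounded_int (x y : R[i]) : x != 0 -> y != 0 ->
  (forall n : int, 1 - x * q ^ n != 0) -> (forall n : int, 1 - y * q ^ n != 0) ->
  exists K : R, forall n : int,
    nm (qpoch q x n / qpoch q y n) <= K * nm (y / x) ^+ negpart n.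
Proof.
move=> x0 y0 hx hy.
have [|K1 h1] := @qpoch_ratio_bounded x y; first by move=> n; exact: (hy n).
have [|K2 h2] := @qpoch_ratio_bounded (q / y) (q / x).
  (* A zero of the reflected denominator at n would make 1 - x q^(-n-1) vanish. *)
  move=> n; have := hx (- n.+1%:Z); rewrite -exprnN.
  have qn : q ^+ n.+1 != 0 by rewrite expf_neq0.
  apply: contraNneq => /eqP; rewrite subr_eq0 => /eqP H.
  rewrite -[X in X - _](_ : x / q ^+ n.+1 * (q / x * q ^+ n) = 1); last first.
    by rewrite exprS; field; rewrite x0 q0 expf_neq0.
  by rewrite -H mulr1 subrr.
exists (Num.max K1 K2) => -[n|n]; first by rewrite mulr1 le_max h1.
rewrite NegzE qpoch_ratioN // -NegzE /= nmM nmX mulrC.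
by rewrite ler_wpM2r ?exprn_ge0 ?nm_ge0 // le_max h2 orbT.
Qed.

End QPochhammerFacts.

(** * Laurent series solutions *)

Section ComplexExponential.
Variable R : realType.
Implicit Types x y : R[i].

Lemma cexpD x y : cexp (x + y) = cexp x * cexp y.
Proof.
case: x y => [u v] [u' v']; rewrite /cexp /= expRD cosD sinD.
by apply/eqP; rewrite eq_complex /=; apply/andP; split; apply/eqP; ring.
Qed.

Lemma cexp0 : cexp 0 = 1 :> R[i].
Proof. by rewrite /cexp /= expR0 cos0 sin0 mul1r. Qed.

Lemma cexp_neq0 x : cexp x != 0.
Proof.
apply/eqP => h; have := cexpD x (- x); rewrite subrr cexp0 h mul0r.
by apply/eqP; rewrite oner_eq0.
Qed.

Lemma cexpN x : cexp (- x) = (cexp x)^-1.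
Proof.
apply: (mulfI (cexp_neq0 x)); rewrite -cexpD subrr cexp0 divff //.
exact: cexp_neq0.
Qed.

Lemma cexpMn x n : cexp (x *+ n) = cexp x ^+ n.
Proof.
by elim: n => [|n IH]; rewrite ?mulr0n ?cexp0 // mulrS cexpD IH exprS.
Qed.

Lemma cexpMz x (n : int) : cexp (x *~ n) = cexp x ^ n.
Proof.
case: n => n; first by rewrite -pmulrn cexpMn.
by rewrite NegzE mulrNz -pmulrn cexpN cexpMn exprnN.
Qed.

Lemma cexp_sum (I : Type) (r : seq I) (P : pred I) (F : I -> R[i]) :
  cexp (\sum_(i <- r | P i) F i) = \prod_(i <- r | P i) cexp (F i).
Proof. by rewrite (big_morph _ cexpD cexp0). Qed.

End ComplexExponential.

Lemma prodD1 (A : comNzRingType) M (F : 'I_M -> A) i :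
  \prod_j F j = F i * \prod_(j | j != i) F j.
Proof. by rewrite (bigD1 i). Qed.

Section Lattice.
Variable M : nat.
Local Notation V := {ffun 'I_M -> int}.

Definition degree (nu : V) : int := \sum_i nu i.

Definition unit_vec (s : 'I_M) : V := [ffun i => (i == s)%:Z].

Lemma degree_unit nu s : degree (nu + unit_vec s) = degree nu + 1.
Proof.
rewrite /degree (eq_bigr (fun i => nu i + (i == s)%:Z)) => [|i _]; last by rewrite !ffunE.
rewrite big_split /=; congr (_ + _).
by rewrite (bigD1 s) //= eqxx big1 ?addr0 // => i /negPf ->.
Qed.

Variable R : realType.

Lemma has_sum_shift (d : V) (g : V -> R[i]) s :
  has_sum g s -> has_sum (fun nu => g (nu + d)) s.
Proof.
move=> hs; apply: (@has_sum_reindex _ _ _ (fun nu => nu - d) (fun nu => nu + d)).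
- by move=> nu; rewrite subrK.
- by move=> nu _; rewrite addrK.
- by move: hs; congr has_sum; apply/funext => nu; rewrite subrK.
Qed.

Definition monomial (t : 'I_M -> R[i]) (nu : V) : R[i] := \prod_i t i ^ nu i.

Lemma monomial_unit (t : 'I_M -> R[i]) nu s : (forall i, t i != 0) ->
  monomial t (nu + unit_vec s) = monomial t nu * t s.
Proof.
move=> t0; rewrite /monomial.
rewrite (eq_bigr (fun i => t i ^ nu i * t i ^ (i == s)%:Z)) => [|i _].
  rewrite big_split /=; congr (_ * _).
  by rewrite (bigD1 s) //= eqxx expr1z big1 ?mulr1 // => i /negPf ->.
by rewrite !ffunE expfzDr.
Qed.

Lemma monomialM (z t : 'I_M -> R[i]) nu :
  (forall i, z i != 0) -> (forall i, t i != 0) ->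
  monomial (fun i => z i * t i) nu = monomial z nu * monomial t nu.
Proof.
move=> z0 t0; rewrite /monomial -big_split; apply: eq_bigr => i _ /=.
by rewrite exprzMl ?unitfE.
Qed.

Lemma monomial_cst (z : R[i]) nu : z != 0 -> monomial (fun=> z) nu = z ^ degree nu.
Proof.
move=> z0; rewrite /monomial /degree.
by rewrite (big_morph (exprz z) (fun m n => expfzDr m n z0) (expr0z _)).
Qed.

Lemma monomial_pulse (z : R[i]) s nu :
  monomial (fun i => if i == s then z else 1) nu = z ^ nu s.
Proof.
rewrite /monomial (prodD1 _ s) eqxx big1 ?mulr1 // => i /negPf ->.
by rewrite exp1rz.
Qed.

End Lattice.

Section LatticeSolution.
Variables (R : realType) (q lq : R[i]).
Hypotheses (q0 : q != 0) (hlq : cexp lq = q).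
Variables (N M : nat) (sigma : 'S_M).
Variables (a : 'I_N -> R[i]) (b : 'I_M -> R[i]) (c : 'I_N -> R[i]).
Local Notation V := {ffun 'I_M -> int}.
Local Notation shift1 := (@Defs.shift1 R lq M).
Local Notation shiftall := (@Defs.shiftall R lq M).
Local Notation point := (logpt R M).

Lemma shift1C r s (x : point) : shift1 r (shift1 s x) = shift1 s (shift1 r x).
Proof.
by apply/funext => i; rewrite /Defs.shift1; case: eqP; case: eqP.
Qed.

Lemma iter_shiftall_shift1 n s (x : point) :
  iter n shiftall (shift1 s x) = shift1 s (iter n shiftall x).
Proof.
elim: n => //= n ->; apply/funext => i; rewrite /Defs.shift1 /Defs.shiftall.
by case: eqP.
Qed.

(** Each summand is an eigenvector of T with eigenvalue [et nu], so a polynomial in T acts termwise.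
    Only the first n iterates of the shift are assumed summable, in accordance with the points that
    the equation requires to lie in the region. *)
Lemma has_sum_prod_one_sub n (a' : 'I_n -> R[i]) (g : logfun R M) (x : point)
    (et w : V -> R[i]) :
  (forall k, (k <= n)%N ->
     has_sum (fun nu => et nu ^+ k * w nu) (g (iter k shiftall x))) ->
  has_sum (fun nu => \prod_j (1 - a' j * et nu) * w nu)
          (prod_one_sub lq a' g x).
Proof.
elim: n a' x w => [|n IH] a' x w h.
  rewrite /prod_one_sub big_ord0; have := h 0%N isT.
  by congr has_sum; apply/funext => nu; rewrite big_ord0 expr0.
rewrite /prod_one_sub big_ord_recl -/(prod_one_sub _ _).
have h1 := IH (fun j => a' (lift ord0 j)) x w (fun k kn => h k (leqW kn)).
(* The induction hypothesis at the shifted point, with [w] replaced by [et * w]. *)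
have h2 : has_sum (fun nu => \prod_j (1 - a' (lift ord0 j) * et nu) * (et nu * w nu))
    (prod_one_sub lq (fun j => a' (lift ord0 j)) g (shiftall x)).
  apply: IH => k kn; rewrite -iterSr; have := h k.+1 kn.
  by congr has_sum; apply/funext => nu; rewrite exprSr mulrA.
have := has_sumB h1 (has_sumZ (a' ord0) h2).
by congr has_sum; apply/funext => nu; rewrite big_ord_recl /=; ring.
Qed.

Variables (Q : 'I_M -> R[i]) (Phi : int -> R[i]) (psi : 'I_M -> int -> R[i]).
Let Qt := \prod_i Q i.
Hypothesis Phi_rec : forall n,
  Phi (n + 1) * \prod_j (1 - c j * Qt * q ^ n) =
  Phi n * \prod_j (1 - a j * Qt * q ^ n).
Hypothesis psi_rec : forall i n,
  psi i (n + 1) * (1 - Q i * q ^ (n + 1)) =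
  psi i n * (1 - b (sigma i) * Q i * q ^ n).

Definition lattice_coef (nu : V) : R[i] := Phi (degree nu) * \prod_i psi i (nu i).

Let X (nu : V) := \prod_i psi i (nu i).

Let X_rec nu s : X (nu + unit_vec s) * (1 - Q s * q ^ (nu s + 1)) =
  X nu * (1 - b (sigma s) * Q s * q ^ nu s).
Proof.
rewrite /X (bigD1 s) //= [in RHS](bigD1 s) //= !ffunE eqxx mulrAC psi_rec.
rewrite -!mulrA; congr (_ * _); rewrite [RHS]mulrC; congr (_ * _).
by apply: eq_bigr => i /negPf si; rewrite !ffunE si addr0.
Qed.

Variables (D : set point) (f : logfun R M) (pre : point -> R[i]).
Hypothesis pre_shift : forall i x, pre (shift1 (sigma i) x) = Q i * pre x.
Let t (x : point) (i : 'I_M) := cexp (x (sigma i)).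
Let w (x : point) (nu : V) := lattice_coef nu * monomial (t x) nu * pre x.
Hypothesis hf : forall x, D x -> has_sum (w x) (f x).
Hypothesis pre_shiftall : forall x, pre (shiftall x) = Qt * pre x.

Let t0 x i : t x i != 0. Proof. exact: cexp_neq0. Qed.

Let w_shift1 x i nu : w (shift1 (sigma i) x) nu = Q i * q ^ nu i * w x nu.
Proof.
rewrite /w pre_shift.
have -> : t (shift1 (sigma i) x) = fun j => (if j == i then q else 1) * t x j.
  apply/funext => j; rewrite /t /Defs.shift1 (inj_eq perm_inj).
  by case: eqP => _; rewrite ?mul1r // cexpD hlq mulrC.
rewrite monomialM // => [|j]; last by case: ifP; rewrite ?oner_eq0.
by rewrite monomial_pulse; ring.

Qed.

Let w_shiftall x nu : w (shiftall x) nu = Qt * q ^ degree nu * w x nu.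
Proof.
rewrite /w pre_shiftall.
have -> : t (shiftall x) = fun j => q * t x j.
  by apply/funext => j; rewrite /t /Defs.shiftall cexpD hlq mulrC.
by rewrite monomialM // monomial_cst //; ring.

Qed.

Let w_iter k x nu : w (iter k shiftall x) nu = (Qt * q ^ degree nu) ^+ k * w x nu.
Proof.
by elim: k => [|k IH]; rewrite ?mul1r //= w_shiftall IH exprS mulrA.
Qed.

(** At t^(nu + e_s) the diagonal equation is the product of one step of [Phi_rec] and one step of
    [psi_rec]; the q in c_j / q is absorbed by the degree rising by 1. At t^(nu + e_r + e_s) both
    sides of the pair equation carry the same value of Phi, and what remains are the steps of psi_r
    and psi_s in either order. *)
Lemma lattice_solution : solution_on lq q a b c D f.
Proof.
split=> [s x hD|r s x rs D0 D1 D2 D3].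
  have [i si] : exists i, s = sigma i by exists (sigma^-1%g s); rewrite permKV.
  rewrite {s}si in hD *.
  have h1 (u : R[i]) k : (k <= N)%N ->
      has_sum (fun nu => (Qt * q ^ degree nu) ^+ k * ((1 - u * (Q i * q ^ nu i)) * w x nu))
        (one_sub u (Tq lq (sigma i)) f (iter k shiftall x)).
    move=> /hD[Dk Dk']; rewrite iter_shiftall_shift1 in Dk'.
    have := has_sumB (hf Dk) (has_sumZ u (hf Dk')).
    by congr has_sum; apply/funext => nu; rewrite w_shift1 w_iter; ring.
  have e1 := has_sumZ (cexp (x (sigma i))) (has_sum_prod_one_sub a (h1 (b (sigma i)))).
  have e2 := has_sum_shift (unit_vec i) (has_sum_prod_one_sub (fun j => c j / q) (h1 1)).
  rewrite /eq_diag; apply/eqP; rewrite subr_eq0; apply/eqP.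
  apply: has_sum_unique e1 _; move: e2; congr has_sum; apply/funext => nu.
  rewrite degree_unit.
  rewrite (eq_bigr (fun j => 1 - c j * Qt * q ^ degree nu)) => [|j _]; last first.
    by rewrite expfzDr // expr1z; field.
  rewrite [in RHS](eq_bigr (fun j => 1 - a j * Qt * q ^ degree nu)) => [|j _]; last by ring.
  rewrite /w /lattice_coef -!/(X _) monomial_unit // degree_unit !ffunE eqxx -/(t x i).
  have -> : 1 - 1 * (Q i * q ^ (nu i + 1%:Z)) = 1 - Q i * q ^ (nu i + 1) by rewrite mul1r.
  have hX := X_rec nu i; have hP := Phi_rec (degree nu).
  set A := \prod_j (1 - a j * _ * _) in hP *.
  set C := \prod_j (1 - c j * _ * _) in hP *.
  transitivity ((Phi (degree nu + 1) * C)
      * (X (nu + unit_vec i) * (1 - Q i * q ^ (nu i + 1)))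
      * monomial (t x) nu * t x i * pre x); first by ring.
  by rewrite hX hP; ring.
have [i ri] : exists i, r = sigma i by exists (sigma^-1%g r); rewrite permKV.
have [j sj] : exists j, s = sigma j by exists (sigma^-1%g s); rewrite permKV.
have ij : i != j by apply: contraTneq rs => ij; rewrite ri sj ij ltnn.
rewrite {}ri {}sj in D1 D2 D3 *.
have h1 (k l : 'I_M) (u : R[i]) : D x -> D (shift1 (sigma k) x) ->
    D (shift1 (sigma l) x) -> D (shift1 (sigma k) (shift1 (sigma l) x)) ->
    has_sum (fun nu : V => (1 - u * (Q k * q ^ nu k)) * (1 - Q l * q ^ nu l) * w x nu)
      (one_sub u (Tq lq (sigma k)) (one_sub 1 (Tq lq (sigma l)) f) x).
  move=> Dx Dk Dl; rewrite shift1C => Dkl.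
  have := has_sumB (has_sumB (hf Dx) (has_sumZ 1 (hf Dl)))
    (has_sumZ u (has_sumB (hf Dk) (has_sumZ 1 (hf Dkl)))).
  by congr has_sum; apply/funext => nu; rewrite !w_shift1; ring.
have D3' := D3; rewrite shift1C in D3'.
(* The factor t_i already raises the exponent by e_i, so translating by e_j here, and by e_i in the
   other sum, reads both sums at t^(nu + e_i + e_j). *)
have e1 := has_sum_shift (unit_vec j)
  (has_sumZ (cexp (x (sigma i))) (h1 i j (b (sigma i)) D0 D1 D2 D3)).
have e2 := has_sum_shift (unit_vec i)
  (has_sumZ (cexp (x (sigma j))) (h1 j i (b (sigma j)) D0 D2 D1 D3')).
rewrite /eq_pair; apply/eqP; rewrite subr_eq0; apply/eqP.
apply: has_sum_unique e1 _; move: e2; congr has_sum; apply/funext => nu.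
rewrite !ffunE !eqxx (negPf ij) eq_sym (negPf ij) !addr0.
rewrite /w /lattice_coef -!/(X _) !monomial_unit // !degree_unit -/(t x i) -/(t x j).
have hi := X_rec nu i; have hj := X_rec nu j.
set p := Phi _; set m := monomial _ _.
transitivity ((X (nu + unit_vec i) * (1 - Q i * q ^ (nu i + 1)))
  * (1 - b (sigma j) * Q j * q ^ nu j) * (t x i * t x j * p * m * pre x)); first by ring.
transitivity ((X (nu + unit_vec j) * (1 - Q j * q ^ (nu j + 1)))
  * (1 - b (sigma i) * Q i * q ^ nu i) * (t x i * t x j * p * m * pre x)); last by ring.
by rewrite hi hj; ring.
Qed.

End LatticeSolution.

(** * Independence of characters *)

Section CharacterIndependence.
Variables (R : realType) (q : R[i]).
Hypothesis q1 : nm q < 1.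
Variables (I : finType) (T : eqType) (M : nat).
Variables (mu : I -> T -> 'I_M -> nat) (z : I -> 'I_M -> R[i]).
Hypothesis z0 : forall p l, z p l != 0.
Local Notation steps := ('I_M -> nat).

Let chi p (n : steps) := \prod_l z p l ^+ n l.
Let wt p t (n : steps) := \prod_l (q ^+ mu p t l) ^+ n l.
Let incr (l : 'I_M) (n : steps) : steps := fun i => (n i + (i == l))%N.

Let prod_incr (F : 'I_M -> R[i]) l n :
  \prod_i F i ^+ incr l n i = F l * \prod_i F i ^+ n i.
Proof.
rewrite /incr; under eq_bigr do rewrite exprD.
rewrite big_split /= mulrC; congr (_ * _).
by rewrite (bigD1 l) //= eqxx expr1 big1 ?mulr1 // => i /negPf ->.
Qed.

(* [S p n] is the p-th function at step n, divided by its character [chi p n]. *)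
Definition vanishing_family (w : I -> T -> R[i]) : Prop :=
  exists2 S : I -> steps -> R[i],
    forall p n, has_sum (fun t => w p t * wt p t n) (S p n) &
    forall n, \sum_p chi p n * S p n = 0.

Let kill (l : 'I_M) (x : R[i]) (w : I -> T -> R[i]) p t :=
  w p t * (z p l * q ^+ mu p t l - x).

(* [kill l x] is the effect of the operator S_l - x on the coefficients. *)
Let vanishing_kill w l x : vanishing_family w -> vanishing_family (kill l x w).
Proof.
move=> [S hS S0]; exists (fun p n => z p l * S p (incr l n) - x * S p n) => [p n|n].
  have := has_sumB (has_sumZ (z p l) (hS p (incr l n))) (has_sumZ x (hS p n)).
  congr has_sum; apply/funext => t; rewrite /wt prod_incr /kill.
  by move: (\prod_l0 _) => P; ring.
transitivity (\sum_p chi p (incr l n) * S p (incr l n) - x * \sum_p chi p n * S p n).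
  rewrite mulr_sumr -sumrB; apply: eq_bigr => p _; rewrite /chi prod_incr.
  by move: (\prod_l0 _) => P; ring.
by rewrite !S0 mulr0 subrr.
Qed.

Let kills (K : seq ('I_M * R[i])) p t : R[i] :=
  \prod_(k <- K) (z p k.1 * q ^+ mu p t k.1 - k.2).

Let vanishing_kills K w : vanishing_family w ->
  vanishing_family (fun p t => w p t * kills K p t).
Proof.
move=> hw; elim: K => [|[l x] K IH].
  move: hw; congr vanishing_family; apply/funext => p; apply/funext => t.
  by rewrite /kills big_nil mulr1.
move/(vanishing_kill l x): IH.
congr vanishing_family; apply/funext => p; apply/funext => t.
by rewrite /kills /kill big_cons /=; ring.
Qed.

Let kills_bounded K p : exists B : R, forall t, nm (kills K p t) <= B.
Proof.
exists (\prod_(k <- K) (nm (z p k.1) + nm k.2)) => t; rewrite /kills nm_prod.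
apply: ler_prod => k _; rewrite nm_ge0 /=.
apply: le_trans (nmD _ _) _; rewrite nmN lerD2r nmM nmX.
by rewrite ler_piMr ?nm_ge0 // exprn_ile1 ?nm_ge0 // ltW.
Qed.

Let small (g : nat -> R) : Prop :=
  forall e : R, 0 < e -> exists n0, forall n, (n0 <= n)%N -> g n < e.

Let small_sum (r : seq I) (P : pred I) (g : I -> nat -> R) :
  (forall p, P p -> small (g p)) -> small (fun n => \sum_(p <- r | P p) g p n).
Proof.
move=> hg; elim: r => [|p r IH] e e0; first by exists 0%N => n _; rewrite big_nil.
have e20 : 0 < e / 2 by rewrite divr_gt0.
have [n1 h1] := IH _ e20.
have [Pp|nPp] := boolP (P p); last first.
  have [n2 h2] := IH _ e0; exists n2 => n hn.
  by rewrite big_cons (negPf nPp) h2.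
have [n2 h2] := hg p Pp _ e20; exists (maxn n1 n2) => n; rewrite geq_max => /andP[a1 a2].
by rewrite big_cons Pp [e]splitr ltrD ?h1 ?h2.
Qed.

Let diag_wt p t n : nm (wt p t (fun=> n)) = \prod_l (nm q ^+ mu p t l) ^+ n.
Proof. by rewrite /wt nm_prod; apply: eq_bigr => l _; rewrite !nmX. Qed.

(** On the diagonal one direction with exponent at least J already gives the decay; the factors of
    the other directions are at most 1. *)
Let diag_wt_le p t l J n : (J <= mu p t l)%N ->
  nm (wt p t (fun=> n)) <= (nm q ^+ J) ^+ n.
Proof.
move=> hJ; rewrite diag_wt (bigD1 l) //=.
have r0 := nm_ge0 q; have r1 := ltW q1.
rewrite -[leRHS]mulr1; apply: ler_pM; rewrite ?exprn_ge0 //.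
- by apply: prodr_ge0 => i _; rewrite !exprn_ge0.
- by apply: lerXn2r; rewrite ?nnegrE ?exprn_ge0 // ler_wiXn2l.
- by apply: prodr_ile1 => i _; rewrite !exprn_ge0 // !exprn_ile1 ?exprn_ge0.
Qed.

Variables (p0 : I) (t0 : T).
Hypothesis mu_t0 : forall l, mu p0 t0 l = 0%N.
Hypothesis inequivalent : forall p, p != p0 ->
  exists l, forall n : nat, z p0 l != z p l * q ^+ n.

(** Along the diagonal steps (n, ..., n), each killed function with p != p0 is O((|Z_p| |q|^J)^n),
    while the one for p0 is its character times the leading coefficient plus O(|q|^n). Dividing the
    vanishing sum by |Z_p0|^n and letting n grow leaves the leading coefficient alone. *)
Lemma vanishing_family_leading (w : I -> T -> R[i]) :
  (forall t, t != t0 -> w p0 t != 0 -> exists l, (0 < mu p0 t l)%N) ->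
  (forall p, bounded_sums (w p)) -> vanishing_family w -> w p0 t0 = 0.
Proof.
move=> mu_pos bw hw.
(* A number of killed terms after which every other function is negligible against the character of
   [p0], even if its own character is larger. *)
have [J hJ] : exists J, forall p,
    nm (\prod_l z p l) * nm q ^+ J < nm (\prod_l z p0 l).
  have pos0 : 0 < nm (\prod_l z p0 l).
    by rewrite lt_def nm_ge0 nm_eq0 andbT prodf_seq_neq0; apply/allP => l _; rewrite z0.
  have /choice[J hJ] p : exists J, forall n, (J <= n)%N ->
      nm (\prod_l z p l) * nm q ^+ n < nm (\prod_l z p0 l).
    by apply: geometric_small; rewrite ?nm_ge0.
  exists (\max_p J p)%N => p; apply: hJ; exact: leq_bigmax.
(* [K] lists, for each p != p0, the values z_p q^j with j < J in a direction where p and p0 are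
   inequivalent. Since mu vanishes at the leading index, inequivalence is exactly what keeps the
   factors nonzero there. *)
have [K [hK K0]] : exists K, (forall p, p \in rem p0 (enum I) -> exists l, forall t,
    (mu p t l < J)%N -> kills K p t = 0) /\ kills K p0 t0 != 0.
  have : all (fun p => p != p0) (rem p0 (enum I)).
    by apply/allP => p; rewrite (mem_rem_uniq _ (enum_uniq _)) => /andP[].
  elim: (rem _ _) => [|p r IH] /=.
    by exists [::]; split=> //; rewrite /kills big_nil oner_eq0.
  move=> /andP[pp0 /IH[K [hK K0]]]; have [l hl] := inequivalent pp0.
  exists (K ++ [seq (l, z p l * q ^+ j) | j <- iota 0 J]).
  have kc p' t : kills (K ++ [seq (l, z p l * q ^+ j) | j <- iota 0 J]) p' t =
      kills K p' t * \prod_(j <- iota 0 J) (z p' l * q ^+ mu p' t l - z p l * q ^+ j).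
    by rewrite /kills big_cat big_map.
  split=> [p'|].
    rewrite inE => /orP[/eqP->|/hK[l' hl']].
      exists l => t tJ; rewrite kc (big_rem (mu p t l)) /= ?mem_iota ?add0n //.
      by rewrite subrr mul0r mulr0.
    by exists l' => t /hl'; rewrite kc => ->; rewrite mul0r.
  rewrite kc mulf_neq0 // prodf_seq_neq0; apply/allP => j _ /=.
  by rewrite mu_t0 expr0 mulr1 subr_eq0.
set w' := fun p t => w p t * kills K p t.
have bw' p : bounded_sums (w' p).
  have [B hB] := kills_bounded K p.
  apply: (bounded_sums_dom (K := B) (bw p)) => t.
  by rewrite nmM mulrC ler_wpM2r ?nm_ge0.
have [S hS S0] := vanishing_kills K hw.
suff : w' p0 t0 = 0 by move/eqP; rewrite mulf_eq0 (negPf K0) orbF => /eqP.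
have /choice[B hB] p := bw' p.
have B0 p : 0 <= B p by have := hB p [::] isT; rewrite big_nil.
set Z := fun p => nm (\prod_l z p l).
have Z0 p : 0 < Z p.
  by rewrite lt_def nm_ge0 nm_eq0 andbT prodf_seq_neq0; apply/allP => l _; rewrite z0.
have chiE p n : nm (chi p (fun=> n)) = Z p ^+ n.
  by rewrite /chi /Z -nmX prodrXl.
have bound_other p n : p != p0 -> nm (S p (fun=> n)) <= B p * (nm q ^+ J) ^+ n.
  move=> pp0; apply: (has_sum_norm_le (hS p (fun=> n))) => A uA.
  have [|l hl] := hK p; first by rewrite (mem_rem_uniq _ (enum_uniq _)) !inE pp0 mem_enum.
  apply: (@le_trans _ _ (\sum_(t <- A) nm (w' p t) * (nm q ^+ J) ^+ n)).
    apply: ler_sum => t _; rewrite nmM.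
    have [tJ|Jt] := ltnP (mu p t l) J.
      by rewrite /w' (hl _ tJ) mulr0 Normc.normc0 !mul0r.
    by rewrite ler_wpM2l ?nm_ge0 //; exact: diag_wt_le Jt.
  by rewrite -mulr_suml ler_wpM2r ?hB // !exprn_ge0 ?nm_ge0.
have bound_self n : nm (S p0 (fun=> n) - w' p0 t0) <= B p0 * nm q ^+ n.
  (* The leading term as a family supported at [t0], so that subtracting it leaves only terms with a
     positive exponent in some direction. *)
  have hp : has_sum (fun t => if t == t0 then w' p0 t0 else 0) (w' p0 t0).
    move=> e e0; exists [:: t0] => A uA sA.
    rewrite (bigD1_seq t0) //= ?sA ?mem_head // eqxx big1 ?addr0 ?subrr ?Normc.normc0 //.
    by move=> t /negPf ->.
  apply: (has_sum_norm_le (has_sumB (hS p0 (fun=> n)) hp)) => A uA.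
  apply: (@le_trans _ _ (\sum_(t <- A) nm (w' p0 t) * nm q ^+ n)).
    apply: ler_sum => t _; case: eqP => [->|/eqP tt0].
      rewrite /wt big1 => [|l _]; last by rewrite mu_t0 expr0 expr1n.
      by rewrite mulr1 subrr Normc.normc0 mulr_ge0 ?exprn_ge0 ?nm_ge0.
    rewrite subr0; have [wt0|/(mu_pos _ tt0)[l hl]] := eqVneq (w p0 t) 0.
      by rewrite /w' wt0 !mul0r Normc.normc0 mul0r.
    by rewrite nmM ler_wpM2l ?nm_ge0 // -[nm q]expr1; exact: diag_wt_le hl.
  by rewrite -mulr_suml ler_wpM2r ?hB // exprn_ge0 ?nm_ge0.
have key n : nm (w' p0 t0) <= B p0 * nm q ^+ n +
    \sum_(p <- enum I | p != p0) B p * (Z p * nm q ^+ J / Z p0) ^+ n.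
  rewrite -(ler_pM2l (exprn_gt0 n (Z0 p0))) -chiE -nmM.
  have := S0 (fun=> n); rewrite (bigD1 p0) //= => Sn.
  have -> : chi p0 (fun=> n) * w' p0 t0 =
    - (chi p0 (fun=> n) * (S p0 (fun=> n) - w' p0 t0) +
       \sum_(p | p != p0) chi p (fun=> n) * S p (fun=> n)).
    move: Sn; set X := \sum_(_ | _) _ => /eqP; rewrite addrC addr_eq0 => /eqP ->.
    by ring.
  rewrite nmN [leRHS]mulrDr; apply: le_trans (nmD _ _) _; apply: lerD.
    by rewrite nmM ler_wpM2l ?nm_ge0.
  apply: le_trans (nm_sum _ _ _) _; rewrite big_enum_cond mulr_sumr /=.
  apply: ler_sum => p pp0; rewrite nmM !chiE.
  have -> : Z p0 ^+ n * (B p * (Z p * nm q ^+ J / Z p0) ^+ n) =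
      Z p ^+ n * (B p * (nm q ^+ J) ^+ n).
    rewrite !exprMn exprVn; have := expf_neq0 n (lt0r_neq0 (Z0 p0)).
    by move: (Z p0 ^+ n) (Z p ^+ n) (_ ^+ n) => x y u x0; field.
  by rewrite ler_wpM2l ?exprn_ge0 ?bound_other // ltW.
apply: nm_small0 => e e0; have e20 : 0 < e / 2 by rewrite divr_gt0.
have [|n1 h1] := @geometric_small _ (nm q) (B p0) _ _ e20; first by rewrite nm_ge0.
have [|n2 h2] := @small_sum (enum I) (fun p => p != p0)
    (fun p n => B p * (Z p * nm q ^+ J / Z p0) ^+ n) _ _ e20.
  move=> p _ d d0; apply: geometric_small => //.
  by rewrite divr_ge0 ?mulr_ge0 ?exprn_ge0 ?nm_ge0 //= ltr_pdivrMr // mul1r hJ.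
apply: le_lt_trans (key (maxn n1 n2)) _.
by rewrite [e]splitr ltrD // ?h1 ?h2 ?leq_maxl ?leq_maxr.
Qed.

End CharacterIndependence.

(** * The local data *)

Section OneSided.
Variable A : comNzRingType.

Definition on_nat (G : nat -> A) (n : int) : A := if n is Posz k then G k else 0.

(** At n = -1, where the sequence jumps from 0 to G 0, the recurrence holds because its left factor
    vanishes. In the reflected version below the jump is from n = 0 to n = 1, and the right factor
    has to vanish. *)
Lemma on_nat_rec (G : nat -> A) (u v : int -> A) :
  u 0 = 0 -> (forall k : nat, G k.+1 * u k.+1 = G k * v k) ->
  forall n, on_nat G (n + 1) * u (n + 1) = on_nat G n * v n.
Proof.
move=> u0 h [k|[|k]].
- have -> : Posz k + 1 = Posz k.+1 by lia.
  exact: h.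
- by rewrite NegzE addNr u0 mulr0 mul0r.
have -> : Negz k.+1 + 1 = Negz k by rewrite !NegzE; lia.
by rewrite !mul0r.
Qed.

Lemma on_nat_opp_rec (G : nat -> A) (u v : int -> A) :
  v 0 = 0 -> (forall k : nat, G k * u (- k%:Z) = G k.+1 * v (- k.+1%:Z)) ->
  forall n, on_nat G (- (n + 1)) * u (n + 1) = on_nat G (- n) * v n.
Proof.
move=> v0 h [[|k]|k]; first by rewrite oppr0 v0 mulr0 mul0r.
  have -> : - (k.+1%:Z + 1) = Negz k.+1 by rewrite NegzE; lia.
  by have -> : - k.+1%:Z = Negz k; rewrite ?NegzE // !mul0r.
have -> : Negz k + 1 = - k%:Z by rewrite NegzE; lia.
by rewrite NegzE !opprK h.
Qed.

Lemma on_nat_neq0 (G : nat -> A) n : on_nat G n != 0 -> 0 <= n.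
Proof. by case: n => //= k; rewrite eqxx. Qed.

End OneSided.

Lemma sub_frac_neq0 (F : fieldType) (u y w : F) :
  1 - u / y * w != 0 -> y != 0 -> y - u * w != 0.
Proof.
move=> h y0; apply: contra h => /eqP h; apply/eqP.
by rewrite -[RHS](mul0r y^-1) -h; field.
Qed.

Section LocalData.
Variables (R : realType) (q : R[i]) (N M L : nat).
Variables (a : 'I_N -> R[i]) (b : 'I_M -> R[i]) (c : 'I_N -> R[i]).
Hypotheses (q0 : q != 0) (q1 : nm q < 1).
Hypotheses (a0 : forall j, a j != 0) (b0 : forall i, b i != 0) (c0 : forall j, c j != 0).
Local Notation tail := (tailprod b).
Hypothesis haa : forall j k, j != k -> forall n : int, 1 - a j / a k * q ^ n != 0.
Hypothesis hcc : forall j k, j != k -> forall n : int, 1 - c j / c k * q ^ n != 0.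
Hypothesis hab : forall j i, (i <= M)%N -> forall n : int, 1 - a j / tail i * q ^ n != 0.
Hypothesis hcb : forall j i, (i <= M)%N -> forall n : int, 1 - c j / tail i * q ^ n != 0.

Local Notation label := (option ('I_N * 'I_M)).

(* [None] stands for u_0 and [Some (k, l)] for u_{k,l}. *)
Definition pivot (k : 'I_N) (l : 'I_M) : R[i] :=
  if (l < L)%N then c k / (q * tail l.+1) else a k / tail l.+1.

(* q^lambda_i, where t^lambda is the prefactor of the solution. *)
Definition multiplier (o : label) (i : 'I_M) : R[i] :=
  match o with
  | None => if (i < L)%N then 1 else (b i)^-1
  | Some (k, l) => if (i < l)%N then 1 else if i == l then (pivot k l)^-1
                   else (b i)^-1
  end.

Definition slot_pos (i : 'I_M) (n : int) : R[i] := on_nat (bfac q b i) n.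
Definition slot_neg (i : 'I_M) (n : int) : R[i] :=
  on_nat (fun k => bfac q b i k * (q / b i) ^+ k) (- n).
(** The two-sided solution of the slot recurrence with multiplier x^-1, where x will be the pivot
    and y the parameter b_l. The sign of the argument anticipates the exchange of nu_l with
    -|nu|. *)
Definition slot_pivot (x y : R[i]) (n : int) : R[i] :=
  qpoch q x (- n) / qpoch q (q * x / y) (- n) * (q / y) ^ (- n).

Definition Psi (o : label) (i : 'I_M) (n : int) : R[i] :=
  match o with
  | None => if (i < L)%N then slot_pos i n else slot_neg i n
  | Some (k, l) => if (i < l)%N then slot_pos i n
                   else if i == l then slot_pivot (pivot k l) (b l) n
                   else slot_neg i n
  end.

(** The factor j = k of the denominator is (q)_n, as for an ordinary one-sided slot; the same holds
    for [coefF]. *)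
Definition coefG (k : 'I_N) (n : nat) : R[i] :=
  \prod_(j < N) (qpoch q (q * a j / c k) n / qpoch q (q * c j / c k) n).
Definition coefF (k : 'I_N) (n : nat) : R[i] :=
  \prod_(j < N) (qpoch q (q * a k / c j) n / qpoch q (q * a k / a j) n).

(** For u_{k,l} the product of the multipliers is q / c_k or 1 / a_k, so the factor j = k of the
    recurrence vanishes between the degrees -1 and 0, or between 0 and 1, and the sequence can be
    cut off there. For u_0 the hypotheses exclude such a zero and the sequence is two-sided. *)
Definition Phi (o : label) (n : int) : R[i] :=
  match o with
  | None => \prod_(j < N) (qpoch q (a j / tail L) n / qpoch q (c j / tail L) n)
  | Some (k, l) =>
      if (l < L)%N then on_nat (coefG k) n
      else on_nat (fun n => coefF k n * (\prod_(j < N) (c j / a j)) ^+ n) (- n)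
  end.

(** * Nonvanishing of the parameters and first order recurrences *)

Lemma one_sub_qX (n : nat) : 1 - q ^+ n.+1 != 0.
Proof.
rewrite subr_eq0; apply/eqP => h; have := congr1 (fun z => nm z) h.
rewrite Normc.normc1 nmX => h'.
have : nm q ^+ n.+1 < 1 by rewrite exprn_ilt1 ?nm_ge0.
by rewrite -h' ltxx.
Qed.

Lemma tail_neq0 l : tail l != 0.
Proof. by apply/prodf_neq0 => i _. Qed.

Lemma tailS (l : 'I_M) : tail l = b l * tail l.+1.
Proof.
rewrite /tailprod (bigD1 l) //=; congr (_ * _); apply: eq_bigl => i.
by rewrite ltn_neqAle andbC eq_sym.
Qed.

Lemma pivot_neq0 k l : pivot k l != 0.
Proof.
by rewrite /pivot; case: ifP => _; rewrite mulf_neq0 ?invr_eq0 ?mulf_neq0 ?tail_neq0.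
Qed.

Lemma pivot_sub k l (n : int) : 1 - pivot k l * q ^ n != 0.
Proof.
rewrite /pivot; case: ifP => _; last exact: hab.
have := @hcb k l.+1 (ltn_ord l) (n - 1); rewrite expfzDr // exprN1 => h.
congr (_ != 0): h; congr (1 - _); field; by rewrite q0 tail_neq0.
Qed.

Lemma pivot_over k l : q * pivot k l / b l =
  if (l < L)%N then c k / tail l else q * a k / tail l.
Proof.
by rewrite /pivot tailS; case: ifP => _; field; rewrite b0 tail_neq0 ?q0.
Qed.

Lemma pivot_over_sub k l (n : int) : 1 - q * pivot k l / b l * q ^ n != 0.
Proof.
rewrite pivot_over; case: ifP => _; first by apply: hcb; exact: ltnW.
have := @hab k l (ltnW (ltn_ord l)) (n + 1); rewrite expfzDr // expr1z => h.
congr (_ != 0): h; congr (1 - _); field; by rewrite tail_neq0.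
Qed.

Lemma bfacS i n : bfac q b i n.+1 * (1 - q ^+ n.+1) = bfac q b i n * (1 - b i * q ^+ n).
Proof.
rewrite /bfac /= !big_nat_recr //= -exprS.
have := one_sub_qX n; set x := 1 - q ^+ n.+1 => x0.
rewrite invfM; set y := (\prod_(_ <= _ < _) _)^-1; set u := \prod_(_ <= _ < _) _.
by field.
Qed.

Lemma slot_pos_rec i n : slot_pos i (n + 1) * (1 - 1 * q ^ (n + 1)) =
  slot_pos i n * (1 - b i * 1 * q ^ n).
Proof.
apply: (on_nat_rec (u := fun n => 1 - 1 * q ^ n) (v := fun n => 1 - b i * 1 * q ^ n)).
  by rewrite expr0z mul1r subrr.
by move=> k; rewrite mul1r mulr1; exact: bfacS.
Qed.

Lemma slot_neg_rec i n : slot_neg i (n + 1) * (1 - (b i)^-1 * q ^ (n + 1)) =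
  slot_neg i n * (1 - b i * (b i)^-1 * q ^ n).
Proof.
apply: (on_nat_opp_rec (u := fun n => 1 - (b i)^-1 * q ^ n)
  (v := fun n => 1 - b i * (b i)^-1 * q ^ n)).
  by rewrite expr0z divff // mulr1 subrr.
move=> k; rewrite divff // mul1r exprS.
have -> : bfac q b i k.+1 = bfac q b i k * (1 - b i * q ^+ k) / (1 - q ^+ k.+1).
  by rewrite -bfacS mulfK // one_sub_qX.
rewrite -!exprnN; have := one_sub_qX k; have := expf_neq0 k q0.
rewrite exprS; move: (q ^+ k) (bfac _ _ _ _) (_ ^+ k) => x y u x0 h.
by field; rewrite h b0 q0 x0.
Qed.

Lemma slot_pivot_rec (x y : R[i]) n : x != 0 -> y != 0 ->
  (forall n : int, 1 - x * q ^ n != 0) -> (forall n : int, 1 - q * x / y * q ^ n != 0) ->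
  slot_pivot x y (n + 1) * (1 - x^-1 * q ^ (n + 1)) =
  slot_pivot x y n * (1 - y * x^-1 * q ^ n).
Proof.
move=> x0 y0 hx hy; rewrite /slot_pivot.
have [m ->] : exists m : int, n = - (m + 1) by exists (- (n + 1)); lia.
have -> : - (m + 1) + 1 = - m by lia.
rewrite !opprK !qpochS ?hx ?hy // !expfzDr ?mulf_neq0 ?invr_eq0 //.
have := hy m; rewrite -!invr_expz expfzDr // !expr1z.
have := expfz_neq0 m q0; have := qpoch_neq0 m hy; have := hx m.
move: (qpoch q x m) (qpoch q _ m) (q ^ m) ((q / y) ^ m) => u v w z h1 v0 w0 h2.
by field; rewrite x0 y0 q0 w0 v0 sub_frac_neq0.
Qed.

Lemma Psi_rec o i n : Psi o i (n + 1) * (1 - multiplier o i * q ^ (n + 1)) =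
  Psi o i n * (1 - b i * multiplier o i * q ^ n).
Proof.
rewrite /Psi /multiplier; case: o => [[k l]|]; last first.
  by case: ifP => _; [exact: slot_pos_rec|exact: slot_neg_rec].
case: ifP => _; first exact: slot_pos_rec.
case: eqP => [->|_]; last exact: slot_neg_rec.
apply: slot_pivot_rec => //; [exact: pivot_neq0|exact: pivot_sub|exact: pivot_over_sub].
Qed.

(** The pivot contains the inverse product of the later b_i, which cancels their multipliers and
    leaves a single parameter. *)
Lemma multiplier_prod o : (L <= M)%N -> \prod_i multiplier o i =
  match o with
  | None => (tail L)^-1
  | Some (k, l) => if (l < L)%N then q / c k else (a k)^-1
  end.
Proof.
move=> LM; case: o => [[k l]|] /=; last first.
  rewrite /tailprod -prodfV [RHS]big_mkcond /=; apply: eq_bigr => i _.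
  by case: ltnP.
have -> : \prod_(i < M) (if (i < l)%N then 1
                         else if i == l then (pivot k l)^-1 else (b i)^-1)
    = (pivot k l)^-1 / tail l.+1.
  rewrite (prodD1 _ l) ltnn eqxx; congr (_ * _).
  rewrite /tailprod -prodfV [LHS]big_mkcond [RHS]big_mkcond /=; apply: eq_bigr => i _.
  by rewrite -val_eqE /=; case: ltngtP.
by rewrite /pivot; case: ifP => _; field; rewrite ?a0 ?c0 ?q0 tail_neq0.
Qed.

Lemma Phi_rec o n : (L <= M)%N ->
  Phi o (n + 1) * \prod_j (1 - c j * (\prod_i multiplier o i) * q ^ n) =
  Phi o n * \prod_j (1 - a j * (\prod_i multiplier o i) * q ^ n).
Proof.
move=> LM; rewrite multiplier_prod //; case: o => [[k l]|] /=; last first.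
  rewrite -!big_split; apply: eq_bigr => j _ /=.
  rewrite !qpochS // => [|_|_]; [|exact: hcb|exact: hab].
  rewrite invfM mulrA mulfVK ?hcb //; exact: mulrAC.
case: ifP => lL.
  (* [on_nat_rec] evaluates its left factor at n + 1, hence the exponent n - 1 here. The required
     zero at 0 is the factor j = k. *)
  have := @on_nat_rec _ (coefG k) (fun n => \prod_j (1 - c j * (q / c k) * q ^ (n - 1)))
    (fun n => \prod_j (1 - a j * (q / c k) * q ^ n)) _ _ n.
  rewrite addrK; apply=> [|m].
    by rewrite (prodD1 _ k) sub0r exprN1 mulrCA divff // mulr1 divff // subrr mul0r.
  rewrite /coefG -!big_split; apply: eq_bigr => j _ /=.
  have -> : m.+1%:Z - 1 = m by lia.
  rewrite !big_nat_recr //= -!exprnP.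
  have h : 1 - q * c j / c k * q ^+ m != 0.
    have [->|jk] := eqVneq j k; first by rewrite mulfK // -exprS one_sub_qX.
    have := hcc jk m.+1; rewrite -exprnP exprS => h.
    by congr (_ != 0): h; congr (1 - _); ring.
  rewrite invfM; move: (\prod_(_ <= _ < _) _) (\prod_(_ <= _ < _) _)^-1 h => u v h.
  by field; rewrite c0 sub_frac_neq0.
have := @on_nat_opp_rec _ (fun n => coefF k n * (\prod_(j < N) (c j / a j)) ^+ n)
  (fun n => \prod_j (1 - c j / a k * q ^ (n - 1)))
  (fun n => \prod_j (1 - a j / a k * q ^ n)) _ _ n.
rewrite addrK; apply=> [|m].
  by rewrite (prodD1 _ k) expr0z divff // mulr1 subrr mul0r.
rewrite /coefF -!prodrXl -!big_split; apply: eq_bigr => j _ /=.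
have -> : - m%:Z - 1 = - m.+1%:Z by lia.
rewrite !big_nat_recr //= -!exprnN !exprS !invfM.
have h : 1 - q * a k / a j * q ^+ m != 0.
  have [->|jk] := eqVneq k j; first by rewrite mulfK // -exprS one_sub_qX.
  have := haa jk m.+1; rewrite -exprnP exprS => h.
  by congr (_ != 0): h; congr (1 - _); ring.
have qm := expf_neq0 m q0.
move: (\prod_(_ <= _ < _) _) (\prod_(_ <= _ < _) _)^-1 h => u v h.
by field; rewrite !a0 c0 q0 qm sub_frac_neq0.
Qed.

(** * From the lattice to the summation variables *)

Local Notation V := {ffun 'I_M -> int}.

(* Exchanges the coordinates nu_l and -|nu|. *)
Definition fold_pivot (l : 'I_M) (eta : V) : V :=
  [ffun i => if i == l then - degree eta else eta i].

Lemma degree_fold_pivot l eta : degree (fold_pivot l eta) = - eta l.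
Proof.
rewrite /degree (bigD1 l) //= ffunE eqxx /degree (bigD1 l) //= opprD -addrA.
rewrite [X in _ + (_ + X)](eq_bigr (fun i : 'I_M => eta i)) ?addNr ?addr0 //.
by move=> i /negPf il; rewrite ffunE il.
Qed.

Lemma fold_pivotK l : involutive (fold_pivot l).
Proof.
move=> eta; apply/ffunP => i; rewrite ffunE; case: eqP => [->|/eqP/negPf il].
  by rewrite degree_fold_pivot opprK.
by rewrite ffunE il.
Qed.

(** In these coordinates all solutions look alike: every slot is one-sided, and the two-sided factor
    depends on the degree. *)
Definition unfold (o : label) (nu : V) : V :=
  if o is Some (_, l) then fold_pivot l nu else nu.

Lemma unfoldK o : involutive (unfold o).
Proof. by case: o => [[k l]|] //=; exact: fold_pivotK. Qed.

(** In unfolded coordinates the slot l of u_{k,l} holds minus the degree of the original exponent,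
    and [Phi] is supported on degrees >= 0 for l < L and <= 0 for L <= l. *)
Definition positive (o : label) (i : 'I_M) : bool :=
  match o with
  | None => (i < L)%N
  | Some (_, l) => (i < l)%N || ((i == l) && (L <= l)%N)
  end.

Definition signed (pos : pred 'I_M) (m : M.-tuple nat) : V :=
  [ffun i => if pos i then (tnth m i)%:Z else - (tnth m i)%:Z].

Lemma degree_signed pos m : degree (signed pos m) = signed_sum pos m.
Proof. by apply: eq_bigr => i _; rewrite ffunE. Qed.

Definition to_lattice o m := unfold o (signed (positive o) m).
Definition of_lattice o nu : M.-tuple nat := [tuple `|unfold o nu i|%N | i < M].

Lemma to_latticeK o : cancel (to_lattice o) (of_lattice o).
Proof.
move=> m; apply: eq_from_tnth => i; rewrite tnth_mktuple unfoldK ffunE.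
by case: ifP; rewrite ?abszN absz_nat.
Qed.

Local Notation coef o := (lattice_coef (Phi o) (Psi o)).

Lemma coef_sign o nu : coef o nu != 0 ->
  forall i, if positive o i then 0 <= unfold o nu i else unfold o nu i <= 0.
Proof.
rewrite mulf_eq0 negb_or => /andP[hPhi /prodf_neq0 hPsi] i; have := hPsi i isT.
rewrite /Psi /positive /unfold; case: o hPhi {hPsi} => [[k l]|] hPhi; last first.
  case: ifP => _ /on_nat_neq0 //; by rewrite oppr_ge0.
rewrite ffunE; have [il|li|/val_inj ->] := ltngtP i l.
- by rewrite -val_eqE /= (ltn_eqF il) => /on_nat_neq0.
- by rewrite -val_eqE /= (gtn_eqF li) => /on_nat_neq0; rewrite oppr_ge0.
rewrite eqxx => _; move: hPhi; rewrite /Phi /= (leqNgt L).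
by case: ifP => _ /on_nat_neq0 //=; rewrite oppr_le0.
Qed.

Lemma of_latticeK o nu : coef o nu != 0 -> to_lattice o (of_lattice o nu) = nu.
Proof.
move=> h; rewrite -[RHS](unfoldK o); congr (unfold o _).
apply/ffunP => i; rewrite ffunE tnth_mktuple; have := coef_sign h i.
by case: ifP => _ hi; [rewrite gez0_abs|rewrite lez0_abs ?opprK].
Qed.

Definition bilateral (o : label) (n : int) : R[i] :=
  if o is Some (k, l)
  then qpoch q (pivot k l) n / qpoch q (q * pivot k l / b l) n
  else Phi None n.

Definition unilateral (o : label) (i : 'I_M) (n : nat) : R[i] :=
  match o with
  | None => bfac q b i n
  | Some (k, l) => if i == l then if (l < L)%N then coefG k n else coefF k n
                   else bfac q b i n
  end.

Definition ratio (o : label) (t : 'I_M -> R[i]) (i : 'I_M) : R[i] :=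
  match o with
  | None => if (i < L)%N then t i else q / (b i * t i)
  | Some (k, l) =>
      if (i < l)%N then q * t i / (b l * t l)
      else if i == l then
        if (l < L)%N then b l * t l / q
        else \prod_(j < N) (c j / a j) * (q / (b l * t l))
      else b l * t l / (b i * t i)
  end.

Definition sliced_term o t (m : M.-tuple nat) : R[i] :=
  bilateral o (signed_sum (positive o) m)
  * \prod_i (unilateral o i (tnth m i) * ratio o t i ^+ tnth m i).

Lemma lattice_sliced o t m : (forall i, t i != 0) ->
  coef o (to_lattice o m) * monomial t (to_lattice o m) = sliced_term o t m.
Proof.
move=> t0; have qt (i : 'I_M) (n : nat) :
    (q / (b i * t i)) ^+ n = (q / b i) ^+ n * t i ^ (- n%:Z).
  by rewrite invfM mulrA exprMn exprVn exprnN.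
rewrite /lattice_coef /sliced_term /monomial /to_lattice.
case: o => [[k l]|] /=; last first.
  rewrite degree_signed -mulrA -big_split; congr (_ * _).
  by apply: eq_bigr => i _ /=; rewrite !ffunE /=; case: ifP => iL;
    rewrite ?iL // /slot_neg opprK qt mulrA.
set o := Some (k, l); set eta := signed (positive o) m.
set n := signed_sum (positive o) m.
(* The two-sided slot contributes y^n, where n is the sum of all coordinates of [eta]. Giving one
   power y^(eta_i) to each slot produces the ratios of the series, such as q t_i / (b_l t_l). *)
pose y := q / (b l * t l).
have y0 : y != 0 by rewrite mulf_neq0 ?invr_eq0 ?mulf_neq0.
have yV (m' : nat) : y ^ (- m'%:Z) = y^-1 ^+ m' by rewrite exprVn exprnN.
have fl : fold_pivot l eta l = - n by rewrite ffunE eqxx degree_signed.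
have fj j : j != l -> fold_pivot l eta j = eta j by move=> /negPf jl; rewrite ffunE jl.
have K1 : Psi o l (- n) * t l ^ (- n) = bilateral o n * \prod_i y ^ eta i.
  rewrite -(big_morph (exprz y) (fun m n => expfzDr m n y0) (expr0z _)).
  rewrite -/(degree eta) degree_signed -/n /Psi /bilateral /o ltnn eqxx.
  rewrite /slot_pivot opprK -[LHS]mulrA.
  congr (_ * _); have -> : y = q / b l * (t l)^-1 by rewrite /y invfM mulrA.
  rewrite [RHS]exprzMl ?unitfE ?invr_eq0 //.
    by rewrite exprz_inv.
  by rewrite mulf_neq0 // invr_eq0.
have K2 : Phi o (- eta l) * y ^ eta l = unilateral o l (tnth m l) * ratio o t l ^+ tnth m l.
  rewrite /eta !ffunE /o /= ltnn eqxx /= (leqNgt L); case: ifP => lL; rewrite ?lL /=.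
    by rewrite opprK yV /y invf_div.
  by rewrite opprK exprMn mulrA.
have K3 j : j != l -> Psi o j (eta j) * t j ^ eta j * y ^ eta j =
    unilateral o j (tnth m j) * ratio o t j ^+ tnth m j.
  move=> jl; rewrite /eta !ffunE /o /= (negPf jl) /= orbF; case: ifP => lj; rewrite ?lj /=.
    rewrite -mulrA -!exprnP -exprMn; congr (_ * _ ^+ _); rewrite /y.
    by field; rewrite b0 t0.
  have -> : t j ^ (- (tnth m j)%:Z) = (t j)^-1 ^+ tnth m j by rewrite -exprnN exprVn.
  rewrite /slot_neg opprK yV /=; move: (bfac _ _ _ _) => B; rewrite -!mulrA; congr (_ * _).
  rewrite -!exprMn.
  by congr (_ ^+ _); rewrite /y; field; rewrite !b0 !t0 q0.
rewrite degree_fold_pivot -mulrA -big_split /= (prodD1 _ l) fl K1 (prodD1 _ l).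
rewrite [in RHS](prodD1 _ l) -K2.
rewrite [X in _ = _ * (_ * X)](eq_bigr (fun j => Psi o j (eta j) * t j ^ eta j * y ^ eta j)).
  rewrite [X in _ * (_ * X) = _](eq_bigr (fun j => Psi o j (eta j) * t j ^ eta j)).
    rewrite [X in _ = _ * (_ * X)]big_split /=.
    by ring.
  by move=> j jl; rewrite fj.
by move=> j /K3.
Qed.

(** * Absolute convergence in the region *)

Definition growth (o : label) : R :=
  if o is Some (_, l) then nm (q / b l) else nm (\prod_(j < N) (c j / a j)).

Lemma bilateral_bounded o : (L <= M)%N ->
  exists K : R, forall n, nm (bilateral o n) <= K * growth o ^+ negpart n.
Proof.
move=> LM; case: o => [[k l]|] /=.
  have [|||| K hK] := @qpoch_ratio_bounded_int _ q q0 q1 (pivot k l) (q * pivot k l / b l).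
  - exact: pivot_neq0.
  - by rewrite mulf_neq0 ?invr_eq0 // mulf_neq0 ?pivot_neq0.
  - exact: pivot_sub.
  - exact: pivot_over_sub.
  exists K => n; have := hK n; congr (_ <= _ * nm _ ^+ _).
  by field; rewrite pivot_neq0 b0.
have /choice[K hK] (j : 'I_N) : exists K : R, forall n,
    nm (qpoch q (a j / tail L) n / qpoch q (c j / tail L) n) <=
    K * nm (c j / a j) ^+ negpart n.
  have [||||K hK] := @qpoch_ratio_bounded_int _ q q0 q1 (a j / tail L) (c j / tail L).
  - by rewrite mulf_neq0 ?invr_eq0 ?tail_neq0.
  - by rewrite mulf_neq0 ?invr_eq0 ?tail_neq0.
  - exact: hab.
  - exact: hcb.
  exists K => n; have := hK n; congr (_ <= _ * nm _ ^+ _).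
  by field; rewrite a0 tail_neq0.
exists (\prod_j K j) => n; rewrite !nm_prod -prodrXl -big_split.
by apply: ler_prod => j _; rewrite nm_ge0 hK.
Qed.

Lemma unilateral_bounded o i : exists K : R, forall n, nm (unilateral o i n) <= K.
Proof.
have prod_bounded (x y : 'I_N -> R[i]) : (forall j (n : nat), 1 - y j * q ^+ n != 0) ->
    exists K : R, forall n : nat, nm (\prod_j (qpoch q (x j) n / qpoch q (y j) n)) <= K.
  move=> hy; have /choice[K hK] j := qpoch_ratio_bounded q1 (x j) (hy j).
  exists (\prod_j K j) => n; rewrite nm_prod.
  by apply: ler_prod => j _; rewrite nm_ge0 hK.
have bb : exists K : R, forall n, nm (bfac q b i n) <= K.
  by apply: (qpoch_ratio_bounded q1 (b i)) => n; rewrite -exprS one_sub_qX.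
case: o => [[k l]|] //=; case: (i == l) => //.
have frac (x y : R[i]) n : 1 - x / y * q ^ n.+1%:Z != 0 -> 1 - q * x / y * q ^+ n != 0.
  by rewrite -exprnP exprS => h; congr (_ != 0): h; congr (1 - _); ring.
case: (l < L)%N; apply: prod_bounded => j n.
  have [->|jk] := eqVneq j k; first by rewrite mulfK // -exprS one_sub_qX.
  by apply: frac; exact: hcc.
have [->|jk] := eqVneq k j; first by rewrite mulfK // -exprS one_sub_qX.
by apply: frac; exact: haa.
Qed.

Definition in_region (t : 'I_M -> R[i]) : Prop :=
  [/\ forall i : 'I_M, (i < L)%N -> nm (t i) < 1,
      forall i : 'I_M, (L <= i)%N ->
        nm (\prod_(j < N) (c j / a j) * (q / (b i * t i))) < 1
    & forall i j : 'I_M, (i < j)%N -> nm (q * t i / (b j * t j)) < 1].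

(** The products of ratios and growth demanded by the convergence criterion collapse to the
    quantities that bound the region: in the pivot slot for l < L, b_l t_l / q times q / b_l is t_l,
    and the ratios of a positive and a negative slot multiply to t_i, to q t_i / (b_j t_j), or to
    the quantity of the second family of conditions. *)
Lemma bounded_sliced o t : (L <= M)%N -> (forall i, t i != 0) -> in_region t ->
  bounded_sums (sliced_term o t).
Proof.
move=> LM t0 [r1 r2 r3].
have [K hK] := bilateral_bounded o LM.
have /choice[B hB] := unilateral_bounded o.
apply: (@bounded_sums_signed _ _ (positive o) (fun i => nm (ratio o t i)) (growth o)
  _ _ _ _ _ _ (K * \prod_i B i)).
- by move=> i; exact: nm_ge0.
- by case: (o) => [[k l]|]; exact: nm_ge0.
- move=> i; case: o {hK hB} => [[k l]|] /=; last by move=> iL; rewrite iL r1.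
  case: ifP => [il _|_]; first exact: r3.
  by case: eqP => //= _ lL; rewrite ltnNge lL r2.
- move=> j; case: o {hK hB} => [[k l]|] /=; last first.
    by move/negPf => jL; rewrite jL -nmM mulrC r2 // leqNgt jL.
  rewrite negb_or -leqNgt => /andP[lj]; rewrite ltnNge lj /= -nmM.
  case: eqP => [_|/eqP jl] /=.
    by rewrite -ltnNge => lL; rewrite lL (_ : _ * _ = t l) ?r1 //; field; rewrite b0 q0.
  move=> _; have lj' : (l < j)%N by rewrite ltn_neqAle lj andbT eq_sym -val_eqE in jl *.
  rewrite (_ : _ * _ = q * t l / (b j * t j)) ?r3 //.
  by field; rewrite !b0 t0.
- move=> i j; rewrite -nmM; case: o {hK hB} => [[k l]|] /=; last first.
    move=> iL /negPf jL; rewrite iL jL (_ : _ * _ = q * t i / (b j * t j)).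
      by apply: r3; apply: leq_trans iL _; rewrite leqNgt jL.
    by field; rewrite b0 t0.
  move=> hi; rewrite negb_or -leqNgt => /andP[lj]; rewrite (ltnNge j) lj /=.
  case: (j =P l) => [_|/eqP jl] /=.
    rewrite -ltnNge => lL; rewrite lL.
    have il : (i < l)%N.
      by case/orP: hi => // /andP[_]; rewrite leqNgt lL.
    rewrite il (_ : _ * _ = t i); last by field; rewrite b0 t0 q0.
    by apply: r1; exact: ltn_trans lL.
  have lj' : (l < j)%N by rewrite ltn_neqAle lj andbT eq_sym -val_eqE in jl *.
  move=> _; case/orP: hi => [il|/andP[/eqP-> lL]].
    rewrite il (_ : _ * _ = q * t i / (b j * t j)) ?r3 ?(ltn_trans il) //.
    by field; rewrite !b0 !t0.
  rewrite ltnn eqxx ltnNge lL /=.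
  rewrite (_ : _ * _ = \prod_(j < N) (c j / a j) * (q / (b j * t j))).
    by apply: r2; exact: leq_trans lj.
  by field; rewrite !b0 !t0.
- move=> m; rewrite /sliced_term nmM nm_prod.
  rewrite mulrACA -big_split /=; apply: ler_pM; rewrite ?nm_ge0 //.
    by apply: prodr_ge0 => i _; rewrite nm_ge0.
  apply: ler_prod => i _; rewrite nm_ge0 nmM nmX /=.
  by rewrite ler_wpM2r ?exprn_ge0 ?nm_ge0.
Qed.

Lemma bounded_lattice o t : (L <= M)%N -> (forall i, t i != 0) -> in_region t ->
  bounded_sums (fun nu : V => coef o nu * monomial t nu).
Proof.
move=> LM t0 ht; apply: (@bounded_sums_reindex _ _ _ (to_lattice o) (of_lattice o)).
  by move=> nu; rewrite mulf_eq0 negb_or => /andP[h _]; exact: of_latticeK.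
have := bounded_sliced o LM t0 ht; congr bounded_sums; apply/funext => m.
by rewrite -lattice_sliced.
Qed.

(** * Identification with the given series *)

Definition series_term (o : label) (t : 'I_M -> R[i]) (m : M.-tuple nat) : R[i] :=
  match o with
  | None => F0_term q a b c t L m
  | Some (k, l) => if (l < L)%N then G_term q a b c t L k l m
                   else F_term q a b c t L k l m
  end.

Definition relabel (e : 'I_M -> 'I_M) (m : M.-tuple nat) : M.-tuple nat :=
  [tuple tnth m (e i) | i < M].

Lemma msplitE (m : M.-tuple nat) l :
  msplit m l = \sum_(i < M) (if (i < l)%N then (tnth m i)%:Z else - (tnth m i)%:Z).
Proof.
rewrite /msplit [RHS](bigID (fun i : 'I_M => (i < l)%N)) /= -sumrN; congr (_ + _).
  by apply: eq_bigr => i il; rewrite il (tnth_nth 0%N).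
rewrite big_mkcond [RHS]big_mkcond; apply: eq_bigr => i _.
by rewrite -leqNgt; case: leqP => // _; rewrite (tnth_nth 0%N).
Qed.

Lemma msplit_relabel (e : 'I_M -> 'I_M) (pos : pred 'I_M) (m : M.-tuple nat) l :
  injective e ->
  (forall i, pos i = (e i < l)%N) -> msplit m l = signed_sum pos (relabel e m).
Proof.
move=> ie he; rewrite msplitE (reindex_inj ie); apply: eq_bigr => i _ /=.
by rewrite tnth_mktuple he.
Qed.

Lemma prod_mul (F G : 'I_M -> R[i]) : \prod_i (F i * G i) = \prod_i F i * \prod_i G i.
Proof. exact: big_split. Qed.

Lemma prod_split_after (G : 'I_M -> R[i]) (l : 'I_M) : (L <= l)%N ->
  \prod_i G i = G l * \prod_(i < M | (i < L)%N) G i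
    * \prod_(i < M | (L <= i < l)%N) G i * \prod_(i < M | (l < i)%N) G i.
Proof.
move=> Ll; rewrite (prodD1 _ l) -!mulrA; congr (_ * _).
rewrite big_mkcond (big_mkcond (fun i : 'I_M => (i < L)%N))
  (big_mkcond (fun i : 'I_M => (L <= i < l)%N)) (big_mkcond (fun i : 'I_M => (l < i)%N)).
rewrite -!big_split; apply: eq_bigr => i _ /=; rewrite -val_eqE /=.
case: (ltngtP i l) => h1 /=; rewrite ?andbT ?andbF.
- by case: ltnP => _; rewrite ?mul1r ?mulr1.
- by rewrite (ltnNge i) (leq_trans Ll (ltnW h1)) /= !mul1r.
- by rewrite h1 (ltnNge l) Ll !mul1r.
Qed.

Lemma prod_split_before (G : 'I_M -> R[i]) (l : 'I_M) : (l < L)%N ->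
  \prod_i G i = G l * \prod_(i < M | (i < l)%N) G i
    * \prod_(i < M | (l < i < L)%N) G i * \prod_(i < M | (L <= i)%N) G i.
Proof.
move=> lL; rewrite (prodD1 _ l) -!mulrA; congr (_ * _).
rewrite big_mkcond (big_mkcond (fun i : 'I_M => (i < l)%N))
  (big_mkcond (fun i : 'I_M => (l < i < L)%N)) (big_mkcond (fun i : 'I_M => (L <= i)%N)).
rewrite -!big_split; apply: eq_bigr => i _ /=; rewrite -val_eqE /=.
case: (ltngtP i l) => h1 /=.
- by rewrite leqNgt (ltn_trans h1 lL) !mulr1.
- by case: ltnP => _; rewrite !mul1r ?mulr1.
- by rewrite h1 leqNgt lL !mul1r.
Qed.

(* In the series F^{L;k,l} and G^{L;k,l} the variable m_{L+1}, resp. m_L, belongs to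
   the total degree, and the variables of the slots between it and l are displaced
   by one; [e] undoes this, giving to slot l the variable of the total degree. *)
Lemma series_term_relabel o : (L <= M)%N -> exists2 e, injective e &
  forall t m, series_term o t m = sliced_term o t (relabel e m).
Proof.
move=> LM; case: o => [[k l]|]; last first.
  exists id => // t m; rewrite /series_term /F0_term /sliced_term.
  rewrite (msplit_relabel (e := id) (pos := positive None)) //.
  rewrite /bilateral /Phi -!mulrA; congr (_ * _).
  rewrite [RHS]big_split /=; congr (_ * _).
    by apply: eq_bigr => i _; rewrite tnth_mktuple (tnth_nth 0%N).
  rewrite big_mkcond [X in _ * X]big_mkcond -big_split; apply: eq_bigr => i _ /=.
  rewrite tnth_mktuple (tnth_nth 0%N).
  by case: ltnP => _; rewrite ?mul1r ?mulr1.
have lM := ltn_ord l.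
have [lL|Ll] := ltnP l L.
  (* A cycle on the positions l, ..., L - 1; counted from 0, the entry m_L sits at L - 1. *)
  pose f (i : nat) := if (i < l)%N then i else if i == l :> nat then L.-1
                      else if (i < L)%N then i.-1 else i.
  have fM (i : 'I_M) : (f i < M)%N.
    by have := ltn_ord i; rewrite /f; do ![case: ifP => ?]; lia.
  pose e (i : 'I_M) := Ordinal (fM i).
  have ie : injective e.
    move=> i j /(congr1 val) /= fij; apply: val_inj; move: fij => /=.
    by rewrite /f; do ![case: ifP => ?]; lia.
  exists e => // t m; have nE i : tnth (relabel e m) i = nth 0%N m (f i).
    by rewrite tnth_mktuple (tnth_nth 0%N).
  pose o := Some (k, l).
  have fl : f l = L.-1 by rewrite /f ltnn eqxx.
  (* Slot l is sent to position L - 1 >= l, so its variable enters with a minus sign. *)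
  have ms : signed_sum (positive o) (relabel e m) = msplit m l.
    rewrite -(@msplit_relabel e _ m l) // => i.
    rewrite /positive /e /= (leqNgt L) lL andbF orbF /f.
    by do ![case: ifP => ?]; lia.
  have Ul n : unilateral o l n = coefG k n by rewrite /= eqxx lL.
  have Rl : ratio o t l = b l * t l / q by rewrite /= ltnn eqxx lL.
  have Bo n : bilateral o n = qpoch q (c k / (q * tail l.+1)) n / qpoch q (c k / tail l) n.
    by rewrite /bilateral /o pivot_over /pivot lL.
  have E1 : \prod_(i < M | (i < l)%N) bfac q b i (nth 0%N m i) =
      \prod_(i < M | (i < l)%N) unilateral o i (tnth (relabel e m) i).
    apply: eq_bigr => i il; rewrite nE /f il /= -val_eqE /= ltn_eqF //.
  have E2 : \prod_(i < M | (l < i < L)%N) bfac q b i (nth 0%N m i.-1) =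
      \prod_(i < M | (l < i < L)%N) unilateral o i (tnth (relabel e m) i).
    apply: eq_bigr => i /andP[li iL].
    by rewrite nE /f ltnNge (ltnW li) /= -val_eqE /= gtn_eqF // iL.
  have E3 : \prod_(i < M | (L <= i)%N) bfac q b i (nth 0%N m i) =
      \prod_(i < M | (L <= i)%N) unilateral o i (tnth (relabel e m) i).
    apply: eq_bigr => i Li; have li := leq_trans lL Li.
    by rewrite nE /f ltnNge (ltnW li) /= -val_eqE /= gtn_eqF // ltnNge Li.
  have F1 : \prod_(i < M | (i < l)%N) (q * t i / (b l * t l)) ^+ nth 0%N m i =
      \prod_(i < M | (i < l)%N) ratio o t i ^+ tnth (relabel e m) i.
    by apply: eq_bigr => i il; rewrite nE /f il /= il.
  have F2 : \prod_(i < M | (l < i < L)%N) (b l * t l / (b i * t i)) ^+ nth 0%N m i.-1 =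
      \prod_(i < M | (l < i < L)%N) ratio o t i ^+ tnth (relabel e m) i.
    apply: eq_bigr => i /andP[li iL].
    by rewrite nE /f /= ltnNge (ltnW li) /= -val_eqE /= gtn_eqF // iL.
  have F3 : \prod_(i < M | (L <= i)%N) (b l * t l / (b i * t i)) ^+ nth 0%N m i =
      \prod_(i < M | (L <= i)%N) ratio o t i ^+ tnth (relabel e m) i.
    apply: eq_bigr => i Li; have li := leq_trans lL Li.
    by rewrite nE /f /= ltnNge (ltnW li) /= -val_eqE /= gtn_eqF // ltnNge Li.
  transitivity (G_term q a b c t L k l m); first by rewrite /series_term lL.
  rewrite /sliced_term -/o prod_mul ms Bo.
  rewrite (prod_split_before (fun i => unilateral o i _) lL).
  rewrite (prod_split_before (fun i => ratio o t i ^+ _) lL) nE fl Ul Rl.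
  by rewrite /G_term E1 E2 E3 F1 F2 F3 -/(coefG k (nth 0%N m L.-1)); ring.
(* The cycle on the positions L, ..., l. Slot l receives position L, which is among the first l + 1,
   so its variable enters with a plus sign. *)
pose f (i : nat) := if (i < L)%N then i else if (i < l)%N then i.+1
                    else if i == l :> nat then L else i.
have fM (i : 'I_M) : (f i < M)%N.
  by have := ltn_ord i; rewrite /f; do ![case: ifP => ?]; lia.
pose e (i : 'I_M) := Ordinal (fM i).
have ie : injective e.
  move=> i j /(congr1 val) /= fij; apply: val_inj; move: fij => /=.
  by rewrite /f; do ![case: ifP => ?]; lia.
exists e => // t m; have nE i : tnth (relabel e m) i = nth 0%N m (f i).
  by rewrite tnth_mktuple (tnth_nth 0%N).
have lL : (l < L)%N = false by rewrite ltnNge Ll.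
pose o := Some (k, l).
have fl : f l = L by rewrite /f lL ltnn eqxx.
have ms : signed_sum (positive o) (relabel e m) = msplit m l.+1.
  rewrite -(@msplit_relabel e _ m l.+1) // => i.
  rewrite /positive /e /= Ll andbT -val_eqE /= /f.
  by do ![case: ifP => ?]; lia.
have Ul n : unilateral o l n = coefF k n by rewrite /= eqxx lL.
have Rl : ratio o t l = \prod_(j < N) (c j / a j) * (q / (b l * t l)).
  by rewrite /= ltnn eqxx lL.
have Bo n : bilateral o n = qpoch q (a k / tail l.+1) n / qpoch q (q * a k / tail l) n.
  by rewrite /bilateral /o pivot_over /pivot lL.
have E1 : \prod_(i < M | (i < L)%N) bfac q b i (nth 0%N m i) =
    \prod_(i < M | (i < L)%N) unilateral o i (tnth (relabel e m) i).
  apply: eq_bigr => i iL; rewrite nE /f iL /= -val_eqE /= ltn_eqF //.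
  exact: leq_trans Ll.
have E2 : \prod_(i < M | (L <= i < l)%N) bfac q b i (nth 0%N m i.+1) =
    \prod_(i < M | (L <= i < l)%N) unilateral o i (tnth (relabel e m) i).
  apply: eq_bigr => i /andP[Li il].
  by rewrite nE /f ltnNge Li /= -val_eqE /= ltn_eqF // il.
have E3 : \prod_(i < M | (l < i)%N) bfac q b i (nth 0%N m i) =
    \prod_(i < M | (l < i)%N) unilateral o i (tnth (relabel e m) i).
  apply: eq_bigr => i li.
  by rewrite nE /f ltnNge (leq_trans Ll (ltnW li)) /= -val_eqE /= gtn_eqF //
    ltnNge (ltnW li).
have F1 : \prod_(i < M | (i < L)%N) (q * t i / (b l * t l)) ^+ nth 0%N m i =
    \prod_(i < M | (i < L)%N) ratio o t i ^+ tnth (relabel e m) i.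
  by apply: eq_bigr => i iL; rewrite nE /f iL /= (leq_trans iL Ll).
have F2 : \prod_(i < M | (L <= i < l)%N) (q * t i / (b l * t l)) ^+ nth 0%N m i.+1 =
    \prod_(i < M | (L <= i < l)%N) ratio o t i ^+ tnth (relabel e m) i.
  by apply: eq_bigr => i /andP[Li il]; rewrite nE /f ltnNge Li /= il.
have F3 : \prod_(i < M | (l < i)%N) (b l * t l / (b i * t i)) ^+ nth 0%N m i =
    \prod_(i < M | (l < i)%N) ratio o t i ^+ tnth (relabel e m) i.
  apply: eq_bigr => i li.
  by rewrite nE /f ltnNge (leq_trans Ll (ltnW li)) /= -val_eqE /= gtn_eqF //
    ltnNge (ltnW li).
transitivity (F_term q a b c t L k l m); first by rewrite /series_term lL.
rewrite /sliced_term -/o prod_mul ms Bo.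
rewrite (prod_split_after (fun i => unilateral o i _) Ll).
rewrite (prod_split_after (fun i => ratio o t i ^+ _) Ll) nE fl Ul Rl.
by rewrite /F_term E1 E2 E3 F1 F2 F3 -/(coefF k (nth 0%N m L)); ring.
Qed.

Lemma relabelK (e e' : 'I_M -> 'I_M) : cancel e e' -> cancel (relabel e') (relabel e).
Proof.
by move=> ee' m; apply: eq_from_tnth => i; rewrite !tnth_mktuple ee'.
Qed.

(** Two changes of index: [relabel] is a bijection of tuples, and [to_lattice] is an injection whose
    image contains the support of the coefficients. *)
Lemma series_expansion o t : (L <= M)%N -> (forall i, t i != 0) -> in_region t ->
  bounded_sums (series_term o t) /\
  has_sum (fun nu : V => coef o nu * monomial t nu) (multisum (series_term o t)).
Proof.
move=> LM t0 ht; have [e ie he] := series_term_relabel o LM.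
have ee := relabelK (invF_f ie); have ee' := relabelK (f_invF ie).
have bs : bounded_sums (series_term o t).
  apply: (@bounded_sums_reindex _ _ _ (relabel (invF ie)) (relabel e)) => [m _|].
    by rewrite ee'.
  have := bounded_sliced o LM t0 ht; congr bounded_sums; apply/funext => m.
  by rewrite he ee.
split=> //; have [s hs] := bounded_has_sum bs; rewrite (has_sum_multisum hs).
apply: (has_sum_reindex (@to_latticeK o)).
  by move=> nu; rewrite mulf_eq0 negb_or => /andP[h _]; exact: of_latticeK.
apply: (has_sum_reindex ee' (h' := relabel (invF ie))) => [m _|]; first by rewrite ee.
by move: hs; congr has_sum; apply/funext => m; rewrite he lattice_sliced.
Qed.

(* Direction l scales t_0, ..., t_l by q if l < L, and t_l, ..., t_(M-1) by 1/q
   otherwise (indices from 0). *)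
Definition dir (l i : 'I_M) : int := (i <= l < L)%N%:Z - (L <= l <= i)%N%:Z.

(** This keeps the bounds on t_i / t_j with i < j valid under the directions, and it yields the
    signs of [fold_dir]. *)
Lemma dir_mono l (i j : 'I_M) : (i <= j)%N -> dir l j <= dir l i.
Proof.
move=> ij; rewrite /dir; have [lL|Ll] := ltnP l L.
  rewrite !andbT !subr0 lez_nat; case: (leqP j l) => // jl.
  by rewrite (leq_trans ij jl).
rewrite !andbF !sub0r /= lerN2 lez_nat; case: (leqP l i) => // li.
by rewrite (leq_trans li ij).
Qed.

Lemma dir_neq (i j : 'I_M) : (i < j)%N -> exists l, dir l i != dir l j.
Proof.
move=> ij; have [iL|Li] := ltnP i L.
  by exists i; rewrite /dir leqnn iL (leqNgt L) iL leqNgt ij.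
have Lj := leq_trans Li (ltnW ij).
by exists j; rewrite /dir leqnn (ltnNge j L) Lj !andbF /= leqNgt ij.
Qed.

Lemma dir_self (i : 'I_M) : dir i i = if (i < L)%N then 1 else -1.
Proof. by rewrite /dir leqnn /=; case: ltnP. Qed.

(** * Weights of monomials along the directions *)

Definition weight (l : 'I_M) (nu : V) : int := \sum_i dir l i * nu i.

(** The same linear form as [weight], written in the unfolded coordinates, where the support of the
    coefficients is described by signs. *)
Definition fold_dir (o : label) (l i : 'I_M) : int :=
  if o is Some (_, p) then if i == p then - dir l p else dir l i - dir l p
  else dir l i.

Lemma weight_unfold o l nu : weight l nu = \sum_i fold_dir o l i * unfold o nu i.
Proof.
rewrite -{1}(unfoldK o nu); move: (unfold o nu) => eta.
rewrite /weight; case: o => [[k p]|] //=.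
rewrite (bigD1 p) //= [RHS](bigD1 p) //= ffunE !eqxx /degree (bigD1 p) //=.
rewrite mulrN mulrDr opprD mulNr -addrA; congr (_ + _).
rewrite mulr_sumr -sumrN -big_split; apply: eq_bigr => i /negPf ip.
by rewrite /= ffunE ip [RHS]mulrBl [LHS]addrC.
Qed.

Lemma dir_sign l (i : 'I_M) : if (i < L)%N then 0 <= dir l i else dir l i <= 0.
Proof.
rewrite /dir; case: ltnP => iL.
  case: (leqP L l) => /= Ll; last by rewrite subr0.
  by rewrite (leqNgt l) (leq_trans iL Ll) andbF.
case: (ltnP l L) => [lL|Ll]; last by rewrite andbF sub0r oppr_le0.
by rewrite (leqNgt i) (leq_trans lL iL).
Qed.

(** The signs of the directions match those of the unfolded coordinates, so a weight is a sum of
    nonnegative terms. This is why only nonnegative powers of q occur along the directions. *)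
Lemma fold_dir_sign o l i :
  if positive o i then 0 <= fold_dir o l i else fold_dir o l i <= 0.
Proof.
case: o => [[k p]|] /=; last exact: dir_sign.
have [->|ip] := eqVneq i p.
  rewrite ltnn /= leqNgt oppr_ge0 oppr_le0; have := dir_sign l p.
  by case: ifP.
rewrite orbF subr_ge0 subr_le0; case: ltnP => h; apply: dir_mono => //.
exact: ltnW.
Qed.

Lemma fold_dir_neq0 o i : exists l, fold_dir o l i != 0.
Proof.
case: o => [[k p]|] /=; last by exists i; rewrite dir_self; case: ifP.
have [_|ip] := eqVneq i p; first by exists p; rewrite dir_self; case: ifP.
have [ip'|pi|/val_inj/eqP] := ltngtP i p; last by rewrite (negPf ip).
  by have [l hl] := dir_neq ip'; exists l; rewrite subr_eq0.
by have [l hl] := dir_neq pi; exists l; rewrite subr_eq0 eq_sym.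
Qed.

Lemma fold_dir_term_ge0 o nu l i : coef o nu != 0 ->
  0 <= fold_dir o l i * unfold o nu i.
Proof.
move=> /coef_sign /(_ i); have := fold_dir_sign o l i; case: ifP => _ h1 h2.
  exact: mulr_ge0.
exact: mulr_le0.
Qed.

Lemma weight_ge0 o nu l : coef o nu != 0 -> 0 <= weight l nu.
Proof.
by move=> h; rewrite (weight_unfold o) sumr_ge0 // => i _; exact: fold_dir_term_ge0.
Qed.

(** The leading term is unique: a sum of nonnegative terms vanishes only if each term does, and
    every slot is seen by some direction. *)
Lemma weight_eq0 o nu : coef o nu != 0 -> (forall l, weight l nu = 0) -> nu = 0.
Proof.
move=> h w0; suff u0 : unfold o nu = 0.
  rewrite -(unfoldK o nu) u0; case: (o) => [[k p]|] //=; apply/ffunP => i.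
  rewrite !ffunE /degree big1 ?oppr0 ?if_same // => j _; exact: ffunE.
apply/ffunP => i; rewrite ffunE; have [l hl] := fold_dir_neq0 o i.
have := w0 l; rewrite (weight_unfold o) => /psumr_eq0P.
move=> /(_ (fun i _ => fold_dir_term_ge0 l i h) i isT) /eqP.
by rewrite mulf_eq0 (negPf hl) /= => /eqP.
Qed.

Lemma lattice_coef0 o : coef o 0 = 1.
Proof.
have d0 : degree (0 : V) = 0 by rewrite /degree big1 // => i _; rewrite ffunE.
have p1 (x y : 'I_N -> R[i]) : \prod_j (qpoch q (x j) 0 / qpoch q (y j) 0) = 1.
  by rewrite big1 // => j _; rewrite !qpoch0 divr1.
have b1 i : bfac q b i 0 = 1 by rewrite /bfac !qpoch0 divr1.
have s1 i : slot_pos i 0 = 1 by exact: b1.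
have s2 i : slot_neg i 0 = 1 by rewrite /slot_neg oppr0 /= b1 mulr1.
rewrite /lattice_coef d0 big1 => [|i _].
  rewrite mulr1 /Phi; case: o => [[k l]|]; last exact: p1.
  by case: ifP => _; rewrite ?oppr0 /= ?mulr1; exact: p1.
rewrite ffunE /Psi; case: o => [[k l]|]; last by case: ifP.
case: ifP => // _; case: ifP => // _.
by rewrite /slot_pivot oppr0 !qpoch0 divr1 mulr1.
Qed.

(* The class modulo q^Z of the character of a solution in direction l depends only
   on this tag. *)
Definition active (o : label) (l : 'I_M) : option 'I_N :=
  if o is Some (k, p) then
    if (if (l < L)%N then (p <= l)%N else (l <= p)%N) then Some k else None
  else None.

Definition direction_value (l : 'I_M) (k : option 'I_N) : R[i] :=
  if (l < L)%N then (if k is Some k then q * tail l.+1 / c k else 1)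
  else (if k is Some k then a k else tail l).

(** * Characters of the solutions along the directions *)

Lemma tail_split (p l : 'I_M) : (p <= l)%N ->
  tail p.+1 = \prod_(i < M | (p < i <= l)%N) b i * tail l.+1.
Proof.
move=> pl; rewrite /tailprod big_mkcond (big_mkcond (fun i : 'I_M => (p < i <= l)%N)).
rewrite (big_mkcond (fun i : 'I_M => (l < i)%N)) -big_split; apply: eq_bigr => i _ /=.
have [il|li] := leqP i l; first by rewrite andbT mulr1.
by rewrite andbF mul1r (leq_ltn_trans pl li).
Qed.

(** Multipliers before the pivot are 1 and those after it are inverse b_i, so together with the tail
    inside the pivot the product telescopes and no longer depends on the position of the pivot. *)
Lemma direction_valueE o l :
  \prod_i multiplier o i ^ dir l i = direction_value l (active o l).
Proof.
rewrite /direction_value /active; case: ifP => lL.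
  have -> : \prod_i multiplier o i ^ dir l i = \prod_(i < M | (i <= l)%N) multiplier o i.
    rewrite [RHS]big_mkcond; apply: eq_bigr => i _.
    by rewrite /dir lL andbT (leqNgt L) lL subr0; case: leqP.
  case: o => [[k p]|] /=; rewrite ?lL; last first.
    by apply: big1 => i il; rewrite (leq_ltn_trans il lL).
  have [pl|lp] := leqP p l; last first.
    by apply: big1 => i il; rewrite (leq_ltn_trans il lp).
  rewrite (bigD1 p) //= ltnn eqxx.
  rewrite [X in _ * X](_ : _ = (\prod_(i < M | (p < i <= l)%N) b i)^-1); last first.
    rewrite -prodfV big_mkcond [RHS]big_mkcond; apply: eq_bigr => i _.
    have [ip|pi|/val_inj ->] := ltngtP i p; last by rewrite eqxx andbF.
      by rewrite /= if_same.
    by rewrite /= -val_eqE /= (gtn_eqF pi) andbT.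
  rewrite /pivot (leq_ltn_trans pl lL) (tail_split pl).
  set P := \prod_(_ | _) _.
  have P0 : P != 0 by apply/prodf_neq0 => i _.
  by field; rewrite c0 q0 tail_neq0 P0.
have Ll : (L <= l)%N by rewrite leqNgt lL.
have -> : \prod_i multiplier o i ^ dir l i = \prod_(i < M | (l <= i)%N) (multiplier o i)^-1.
  rewrite [RHS]big_mkcond; apply: eq_bigr => i _.
  by rewrite /dir lL andbF Ll sub0r; case: leqP => _ /=; rewrite ?exprN1 ?oppr0.
case: o => [[k p]|] /=; rewrite ?lL; last first.
  apply: eq_bigr => i li; rewrite ltnNge (leq_trans Ll li) /=; exact: invrK.
have [lp|pl] := leqP l p; last first.
  apply: eq_bigr => i li; have pi := leq_trans pl li.
  by rewrite ltnNge (ltnW pi) /= -val_eqE /= (gtn_eqF pi) invrK.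
rewrite (bigD1 p) //= ltnn eqxx invrK /pivot ltnNge (leq_trans Ll lp) /=.
rewrite [X in _ * X](_ : _ = tail p.+1) ?divfK ?tail_neq0 //.
rewrite /tailprod big_mkcond [RHS]big_mkcond; apply: eq_bigr => i _.
have [ip|pi|/val_inj ->] := ltngtP i p; last by rewrite eqxx andbF.
  by rewrite invr1 if_same.
by rewrite (leq_trans lp (ltnW pi)) /= -val_eqE /= (gtn_eqF pi) invrK.
Qed.

(** Each pair of tags consumes one non-resonance condition: two indices k use [hcc] or [haa], and an
    index against the inactive tag uses [hcb] or [hab]. *)
Lemma direction_value_inequiv l (k k' : option 'I_N) (n : nat) : k != k' ->
  direction_value l k != direction_value l k' * q ^+ n.
Proof.
have lM := ltn_ord l; have qn := expf_neq0 n q0.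
have sub1 (x y : R[i]) : 1 - x * y != 0 -> 1 = x * y -> False.
  by move=> h e; move: h; rewrite -e subrr eqxx.
have T0 := tail_neq0.
rewrite /direction_value => kk'; apply/eqP; case: ifP => _;
  case: k k' kk' => [k|] [k'|] //= kk' e.
- apply: sub1 (hcc kk' n) _; rewrite -exprnP.
  have -> : q ^+ n = c k' / c k.
    apply: (mulfI (_ : q * tail l.+1 / c k' != 0)).
      by rewrite !mulf_neq0 ?invr_eq0.
    by rewrite -e; field; rewrite !c0.
  by field; rewrite !c0.
- apply: sub1 (@hcb k l.+1 lM (n%:Z - 1)) _.
  rewrite expfzDr // -exprnP exprN1.
  by rewrite mul1r in e; rewrite -e; field; rewrite c0 q0 T0.
- apply: sub1 (@hcb k' l.+1 lM (- n.+1%:Z)) _; rewrite -exprnN exprS.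
  have -> : 1 = (q * tail l.+1 / c k' * q ^+ n)^-1 :> R[i] by rewrite -e invr1.
  by field; rewrite !c0 T0 q0 qn.
- apply: sub1 (haa kk' (- n%:Z)) _; rewrite -exprnN e.
  by field; rewrite !a0 qn.
- apply: sub1 (@hab k l (ltnW lM) (- n%:Z)) _; rewrite -exprnN e.
  by field; rewrite T0 qn.
- apply: sub1 (@hab k' l (ltnW lM) n) _; rewrite -exprnP.
  by rewrite mulrAC -e divff.
Qed.

(** For p < p', direction p sees only the first pivot if p < L, and direction p' only the second if
    L <= p. If k and k' differ, a direction that sees both pivots also separates the tags. *)
Lemma active_neq_le k k' (p p' : 'I_M) : (k, p) != (k', p') -> (p <= p')%N ->
  exists l, active (Some (k, p)) l != active (Some (k', p')) l.
Proof.
move=> ne pp'; have [pL|Lp] := ltnP p L.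
  have [p'p|/negPf np'p] := boolP (p' <= p)%N.
    have epp : p = p' by apply/val_inj/eqP; rewrite eqn_leq pp' p'p.
    exists p; rewrite /active pL leqnn p'p.
    by apply: contra ne => /eqP[->]; rewrite epp.
  have [p'L|Lp'] := ltnP p' L; last by exists p; rewrite /active pL leqnn np'p.
  have [ekk|kk] := eqVneq k k'; first by exists p; rewrite /active pL leqnn np'p.
  by exists p'; rewrite /active p'L leqnn pp'; apply: contra kk => /eqP[->].
have nL i : (L <= i)%N -> (i < L)%N = false by move=> Li; rewrite ltnNge Li.
have Lp' := leq_trans Lp pp'.
have [ekk|kk] := eqVneq k k'; last first.
  by exists p; rewrite /active nL // leqnn pp'; apply: contra kk => /eqP[->].
exists p'; rewrite /active nL // leqnn; case: ifP => // p'p.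
have epp : p = p' by apply/val_inj/eqP; rewrite eqn_leq pp' p'p.
by rewrite ekk epp eqxx in ne.
Qed.

Lemma active_neq (o o' : label) : o != o' -> exists l, active o l != active o' l.
Proof.
case: o o' => [[k p]|] [[k' p']|] //= ne; last first.
- by exists p'; rewrite !leqnn if_same.
- by exists p; rewrite !leqnn if_same.
have [pp'|/ltnW p'p] := leqP p p'; first exact: active_neq_le.
rewrite eq_sym in ne; have [l hl] := active_neq_le ne p'p.
by exists l; rewrite eq_sym.
Qed.
End LocalData.

(** * Moving inside the region *)

Section IntegerTranslations.
Variables (R : realType) (lq : R[i]) (M : nat) (sigma : 'S_M).
Local Notation V := {ffun 'I_M -> int}.
Local Notation point := (logpt R M).

Definition translate (k : V) (x : point) : point :=
  fun j => x j + lq *~ k (sigma^-1%g j).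

Lemma translateE k x i : translate k x (sigma i) = x (sigma i) + lq *~ k i.
Proof. by rewrite /translate permK. Qed.

Lemma translateD k k' x : translate (k + k') x = translate k (translate k' x).
Proof.
apply/funext => j; rewrite /translate ffunE mulrzDr -addrA; congr (_ + _).
exact: addrC.
Qed.

(** The translations that leave [C] invariant at every point form a subgroup of Z^M, and it contains
    the unit vectors. *)
Lemma pseudo_constant_translate (C : logfun R M) k x :
  pseudo_constant lq C -> C (translate k x) = C x.
Proof.
move=> hC.
pose P (k : V) := forall x, C (translate k x) = C x.
have P0 : P 0.
  move=> y; congr C; apply/funext => j; rewrite /translate ffunE.
  by rewrite mulr0z addr0.
have PD k1 k2 : P k1 -> P k2 -> P (k1 + k2).
  by move=> h1 h2 y; rewrite translateD h1 h2.
have PN k1 : P k1 -> P (- k1).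
  by move=> h1 y; rewrite -h1 -translateD subrr P0.
have P1 i : P (unit_vec i).
  move=> y; rewrite -[RHS](congr1 (fun f => f y) (hC (sigma i))); congr C.
  apply/funext => j; rewrite /translate /shift1 ffunE.
  rewrite (can2_eq (permKV sigma) (permK sigma)).
  by case: eqP => _; rewrite ?mulr1z // mulr0z addr0.
pose pulse i n : V := [ffun j => if j == i then n else 0].
have Ppulse i (n : nat) : P (pulse i n%:Z).
  elim: n => [|n IH].
    suff -> : pulse i 0 = 0 by [].
    by apply/ffunP => j; rewrite !ffunE if_same.
  suff -> : pulse i n.+1 = pulse i n + unit_vec i by exact: PD.
  by apply/ffunP => j; rewrite !ffunE; case: eqP => _ //=; lia.
have Pz i n : P (pulse i n).
  case: n => n //; suff -> : pulse i (Negz n) = - pulse i n.+1 by exact: PN.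
  by apply/ffunP => j; rewrite !ffunE NegzE; case: eqP => _; rewrite ?oppr0.
suff -> : k = \sum_i pulse i (k i).
  by apply: (big_ind P) => // i _; exact: Pz.
apply/ffunP => j; rewrite sum_ffunE (bigD1 j) //= ffunE eqxx big1 ?addr0 //.
by move=> i ij; rewrite ffunE eq_sym (negPf ij).
Qed.

End IntegerTranslations.

Section Deepening.
Variables (R : realType) (q : R[i]) (N M L : nat).
Variables (a : 'I_N -> R[i]) (b : 'I_M -> R[i]) (c : 'I_N -> R[i]).
Hypotheses (q0 : q != 0) (q1 : nm q < 1).
Local Notation V := {ffun 'I_M -> int}.

Definition steps_vec (n : 'I_M -> nat) : V := [ffun i => \sum_l dir L l i * (n l)%:Z].

Lemma prod_steps_vec (w : 'I_M -> R[i]) n : (forall i, w i != 0) ->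
  \prod_i w i ^ steps_vec n i = \prod_l (\prod_i w i ^ dir L l i) ^+ n l.
Proof.
move=> w0; under eq_bigr => i _.
  rewrite ffunE (big_morph (exprz (w i)) (fun x y => expfzDr x y (w0 i)) (expr0z _)).
  under eq_bigr do rewrite -exprz_exp.
  over.
rewrite exchange_big /=; apply: eq_bigr => l _.
by rewrite -prodrXl; apply: eq_bigr.
Qed.

Lemma steps_vec_monomial n (nu : V) :
  monomial (fun i => q ^ steps_vec n i) nu = \prod_l (q ^ weight L l nu) ^+ n l.
Proof.
rewrite /monomial (eq_bigr (fun i => (q ^ nu i) ^ steps_vec n i)) => [|i _]; last first.
  by rewrite !exprz_exp mulrC.
rewrite prod_steps_vec => [|i]; last exact: expfz_neq0.
apply: eq_bigr => l _; congr (_ ^+ _); rewrite /weight.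
rewrite (big_morph (exprz q) (fun x y => expfzDr x y q0) (expr0z _)).
by apply: eq_bigr => i _; rewrite exprz_exp mulrC.
Qed.

Section Bounds.
Variables (n : 'I_M -> nat) (K : nat).
Hypothesis hK : forall l, (K <= n l)%N.

Lemma steps_vec_inside (i : 'I_M) : (i < L)%N -> K%:Z <= steps_vec n i.
Proof.
move=> iL; rewrite ffunE (bigD1 i) //= dir_self iL mul1r.
apply: (@le_trans _ _ (n i)%:Z); first by rewrite lez_nat.
rewrite lerDl sumr_ge0 // => l _; have := dir_sign L l i; rewrite iL => h.
exact: mulr_ge0.
Qed.

Lemma steps_vec_outside (i : 'I_M) : (L <= i)%N -> K%:Z <= - steps_vec n i.
Proof.
move=> Li; have iL : (i < L)%N = false by rewrite ltnNge Li.
rewrite ffunE (bigD1 i) //= dir_self iL mulN1r opprD opprK.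
apply: (@le_trans _ _ (n i)%:Z); first by rewrite lez_nat.
rewrite lerDl oppr_ge0 sumr_le0 // => l _; have := dir_sign L l i; rewrite iL => h.
by rewrite mulr_le0_ge0.
Qed.

Lemma steps_vec_decr (i j : 'I_M) : (i < j)%N ->
  K%:Z <= steps_vec n i - steps_vec n j.
Proof.
move=> ij; rewrite !ffunE -sumrB; have [l hl] := dir_neq L ij.
have d0 l' : 0 <= dir L l' i - dir L l' j by rewrite subr_ge0 dir_mono // ltnW.
rewrite (bigD1 l) //= -mulrBl.
apply: (@le_trans _ _ (n l)%:Z); first by rewrite lez_nat.
apply: (@le_trans _ _ ((dir L l i - dir L l j) * n l)).
  (* The difference is a nonnegative nonzero integer. *)
  have : 1 <= dir L l i - dir L l j by have := d0 l; move: hl; lia.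
  by move=> h; rewrite ler_peMl.
by rewrite lerDl sumr_ge0 // => l' _; rewrite -mulrBl mulr_ge0.
Qed.

End Bounds.

Lemma nm_exprz_le (k : int) (K : nat) : K%:Z <= k -> nm (q ^ k) <= nm q ^+ K.
Proof.
case: k => [k|k] // Kk; rewrite nmX ler_wiXn2l ?nm_ge0 // ltW //.
Qed.

(** With K = 0 this is the invariance of the region under the directions; with K large it moves an
    arbitrary point into the region. *)
Lemma in_region_translate (n : 'I_M -> nat) K (t : 'I_M -> R[i]) :
  (forall i, t i != 0) -> (forall i, b i != 0) -> (forall l, (K <= n l)%N) ->
  [/\ forall i : 'I_M, (i < L)%N -> nm (t i) * nm q ^+ K < 1,
      forall i : 'I_M, (L <= i)%N ->
        nm (\prod_(j < N) (c j / a j) * (q / (b i * t i))) * nm q ^+ K < 1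
    & forall i j : 'I_M, (i < j)%N -> nm (q * t i / (b j * t j)) * nm q ^+ K < 1] ->
  in_region q L a b c (fun i => t i * q ^ steps_vec n i).
Proof.
move=> t0 b0 hK [r1 r2 r3].
have qz k : q ^ k != 0 by exact: expfz_neq0.
split=> [i iL|i Li|i j ij].
- rewrite nmM; apply: le_lt_trans (r1 i iL).
  by rewrite ler_wpM2l ?nm_ge0 // nm_exprz_le // steps_vec_inside.
- rewrite [X in nm X](_ : _ = \prod_(j < N) (c j / a j) * (q / (b i * t i))
    * q ^ (- steps_vec n i)); last first.
    by rewrite -invr_expz; field; rewrite b0 t0 qz.
  rewrite nmM; apply: le_lt_trans (r2 i Li).
  by rewrite ler_wpM2l ?nm_ge0 // nm_exprz_le // steps_vec_outside.
rewrite [X in nm X](_ : _ = q * t i / (b j * t j)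
  * q ^ (steps_vec n i - steps_vec n j)); last first.
  by rewrite expfzDr // -invr_expz; field; rewrite b0 t0 qz.
rewrite nmM; apply: le_lt_trans (r3 i j ij).
by rewrite ler_wpM2l ?nm_ge0 // nm_exprz_le // steps_vec_decr.
Qed.

Lemma exists_in_region (t : 'I_M -> R[i]) : exists K : nat,
  [/\ forall i : 'I_M, (i < L)%N -> nm (t i) * nm q ^+ K < 1,
      forall i : 'I_M, (L <= i)%N ->
        nm (\prod_(j < N) (c j / a j) * (q / (b i * t i))) * nm q ^+ K < 1
    & forall i j : 'I_M, (i < j)%N -> nm (q * t i / (b j * t j)) * nm q ^+ K < 1].
Proof.
have small (x : R) : exists K, forall n, (K <= n)%N -> x * nm q ^+ n < 1.
  by apply: geometric_small => //; rewrite nm_ge0.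
have /choice[K1 h1] i := small (nm (t i)).
have /choice[K2 h2] i := small (nm (\prod_(j < N) (c j / a j) * (q / (b i * t i)))).
have /choice[K3 h3] (ij : 'I_M * 'I_M) := small (nm (q * t ij.1 / (b ij.2 * t ij.2))).
exists (maxn (\max_i K1 i) (maxn (\max_i K2 i) (\max_ij K3 ij))); split=> [i _|i _|i j _].
- by apply: h1; rewrite !leq_max leq_bigmax.
- by apply: h2; rewrite !leq_max (leq_bigmax i) orbT.
- by apply: (h3 (i, j)); rewrite !leq_max (leq_bigmax (i, j)) !orbT.
Qed.

End Deepening.

(** * The fundamental solution *)

Section FundamentalSolution.
Variables (R : realType) (q lq : R[i]).
Hypotheses (hq : 0 < `|q| < 1) (hlq : cexp lq = q).
Variables (N M L : nat).
Hypothesis LM : (L <= M)%N.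
Variable sigma : 'S_M.
Variables (alpha : 'I_N -> R[i]) (beta : 'I_M -> R[i]) (gamma : 'I_N -> R[i]).
Variables (a : 'I_N -> R[i]) (b : 'I_M -> R[i]) (c : 'I_N -> R[i]).
Hypotheses (ha : forall j, a j = cexp (alpha j * lq))
  (hb : forall i, b i = cexp (beta i * lq))
  (hc : forall j, c j = cexp (gamma j * lq)).
Hypotheses (haa : forall j k : 'I_N, j != k -> ~ qZ q (a j / a k))
  (hcc : forall j k : 'I_N, j != k -> ~ qZ q (c j / c k)).
Local Notation bs := (fun i => b (sigma i)).
Hypotheses
  (hab : forall (j : 'I_N) (i : nat), (i <= M)%N -> ~ qZ q (a j / tailprod bs i))
  (hcb : forall (j : 'I_N) (i : nat), (i <= M)%N -> ~ qZ q (c j / tailprod bs i)).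

Local Notation V := {ffun 'I_M -> int}.
Local Notation point := (logpt R M).
Local Notation label := (option ('I_N * 'I_M)).
Local Notation D := (region q a b c L sigma).
Local Notation coef o := (lattice_coef (Phi q L a bs c o) (Psi q L a bs c o)).
Local Notation mult o := (multiplier q L a bs c o).

Let tpt (x : point) (i : 'I_M) : R[i] := cexp (x (sigma i)).

Let q1 : nm q < 1.
Proof. by case/andP: hq => _; rewrite -nm_norm ltcR. Qed.

Let q0 : q != 0.
Proof. by case/andP: hq => h _; rewrite -normr_gt0. Qed.

Let a0 j : a j != 0. Proof. by rewrite ha cexp_neq0. Qed.
Let b0 i : bs i != 0. Proof. by rewrite /= hb cexp_neq0. Qed.
Let c0 j : c j != 0. Proof. by rewrite hc cexp_neq0. Qed.
Let t0 x i : tpt x i != 0. Proof. exact: cexp_neq0. Qed.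

Let not_qZ z : ~ qZ q z -> forall n : int, 1 - z * q ^ n != 0.
Proof.
move=> hz n; apply/eqP => /eqP; rewrite subr_eq0 => /eqP e; apply: hz.
exists (- n) => //; rewrite -invr_expz -[LHS]mul1r e mulfK //.
exact: expfz_neq0.
Qed.

Let haa' j k : j != k -> forall n : int, 1 - a j / a k * q ^ n != 0.
Proof. by move=> jk; apply: not_qZ; exact: haa. Qed.
Let hcc' j k : j != k -> forall n : int, 1 - c j / c k * q ^ n != 0.
Proof. by move=> jk; apply: not_qZ; exact: hcc. Qed.
Let hab' j i : (i <= M)%N -> forall n : int, 1 - a j / tailprod bs i * q ^ n != 0.
Proof. by move=> iM; apply: not_qZ; exact: hab. Qed.
Let hcb' j i : (i <= M)%N -> forall n : int, 1 - c j / tailprod bs i * q ^ n != 0.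
Proof. by move=> iM; apply: not_qZ; exact: hcb. Qed.

Definition exponent (o : label) (i : 'I_M) : R[i] :=
  match o with
  | None => if (i < L)%N then 0 else - beta (sigma i)
  | Some (k, l) =>
      if (i < l)%N then 0
      else if i == l then
        if (l < L)%N then 1 + \sum_(i < M | (l < i)%N) beta (sigma i) - gamma k
        else - alpha k + \sum_(i < M | (l < i)%N) beta (sigma i)
      else - beta (sigma i)
  end.

Let multiplierE o i : mult o i = cexp (exponent o i * lq).
Proof.
have tailE l : tailprod bs l = cexp (\sum_(i < M | (l <= i)%N) beta (sigma i) * lq).
  rewrite /tailprod cexp_sum; apply: eq_bigr => j _; exact: hb.
rewrite /multiplier /exponent; case: o => [[k l]|]; last first.
  by case: ifP => _; rewrite ?mul0r ?cexp0 // mulNr cexpN -hb.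
case: ifP => _; first by rewrite mul0r cexp0.
case: ifP => _; last by rewrite mulNr cexpN -hb.
rewrite /pivot; case: ifP => _.
  rewrite mulrBl mulrDl mul1r !cexpD cexpN mulr_suml hlq -tailE -hc.
  by rewrite invf_div.
by rewrite mulrDl mulr_suml mulNr cexpD cexpN -ha -tailE invf_div mulrC.
Qed.

Definition prefactor (o : label) (x : point) : R[i] :=
  \prod_i cexp (exponent o i * x (sigma i)).

Definition solution (o : label) : logfun R M :=
  match o with
  | None => u0 q beta a b c L sigma
  | Some (k, l) => ukl q alpha beta gamma a b c L sigma k l
  end.

Let ukl_termE k l x : ukl_term q a b c L sigma k l x =
  series_term q L a bs c (Some (k, l)) (tpt x).
Proof. by apply/funext => m; rewrite /ukl_term /series_term; case: ifP. Qed.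

Let solutionE o x :
  solution o x = prefactor o x * multisum (series_term q L a bs c o (tpt x)).
Proof.
rewrite /prefactor; case: o => [[k l]|] /=; last first.
  rewrite /u0; congr (_ * _); rewrite big_mkcond; apply: eq_bigr => i _.
  by case: ltnP => // _; rewrite mul0r cexp0.
rewrite /ukl; congr (_ * _); last first.
  by rewrite ukl_termE.
rewrite (prodD1 _ l) ltnn eqxx; congr (_ * _).
rewrite big_mkcond [RHS]big_mkcond; apply: eq_bigr => i _.
by rewrite -val_eqE /=; case: ltngtP => // _; rewrite mul0r cexp0.
Qed.

Let prefactor_neq0 o x : prefactor o x != 0.
Proof. by apply/prodf_neq0 => i _; exact: cexp_neq0. Qed.

Let prefactor_shift1 o i x :
  prefactor o (shift1 lq (sigma i) x) = mult o i * prefactor o x.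
Proof.
rewrite /prefactor (prodD1 _ i) (prodD1 (fun j => cexp (exponent o j * x (sigma j))) i).
rewrite [RHS]mulrA; congr (_ * _).
  by rewrite /shift1 eqxx mulrDr cexpD multiplierE mulrC.
by apply: eq_bigr => j ji; rewrite /shift1 (inj_eq perm_inj) (negPf ji).
Qed.

Let prefactor_shiftall o x :
  prefactor o (shiftall lq x) = (\prod_i mult o i) * prefactor o x.
Proof.
rewrite /prefactor -prod_mul; apply: eq_bigr => i _.
by rewrite /shiftall mulrDr cexpD multiplierE mulrC.
Qed.

Let prefactor_translate o k x :
  prefactor o (translate lq sigma k x) = (\prod_i mult o i ^ k i) * prefactor o x.
Proof.
rewrite /prefactor -prod_mul; apply: eq_bigr => i _.
by rewrite translateE mulrDr cexpD multiplierE mulrC mulrzAr cexpMz.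
Qed.

Let regionE x : D x <-> in_region q L a bs c (tpt x).
Proof.
have nmE (z : R[i]) : (`|z| < 1) = (nm z < 1) by rewrite -nm_norm ltcR.
split=> [[h1 h2 h3]|[h1 h2 h3]]; split=> [i iL|i Li|i j ij].
- by rewrite -nmE; exact: h1.
- by rewrite -nmE; exact: h2.
- by rewrite -nmE; exact: h3.
- by rewrite nmE; exact: h1.
- by rewrite nmE; exact: h2.
- by rewrite nmE; exact: h3.
Qed.

Let expansion o x : D x ->
  bounded_sums (series_term q L a bs c o (tpt x)) /\
  has_sum (fun nu : V => coef o nu * monomial (tpt x) nu)
    (multisum (series_term q L a bs c o (tpt x))).
Proof.
move=> /regionE; exact: (series_expansion q0 q1 a0 b0 c0 haa' hcc' hab' hcb' o LM (t0 x)).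
Qed.

Lemma series_converge : series_converge_on q a b c L sigma D.
Proof.
move=> x Dx; split=> [|k l].
  exact: bounded_abs_summable (proj1 (expansion None Dx)).
rewrite ukl_termE; exact: bounded_abs_summable (proj1 (expansion (Some (k, l)) Dx)).
Qed.

Lemma solution_solves o : solution_on lq q a b c D (solution o).
Proof.
apply: (@lattice_solution _ q lq q0 hlq N M sigma a b c (mult o) (Phi q L a bs c o)
  (Psi q L a bs c o) _ _ D (solution o) (prefactor o)).
- by move=> n; exact: (Phi_rec q0 q1 a0 b0 c0 haa' hcc' hab' hcb').
- by move=> i n; apply: Psi_rec.
- by move=> i x; exact: prefactor_shift1.
- move=> x Dx; rewrite solutionE.
  have := has_sumZ (prefactor o x) (proj2 (expansion o Dx)).
  by congr has_sum; apply/funext => nu; rewrite mulrC.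
- by move=> x; exact: prefactor_shiftall.
Qed.

Let tpt_translate n x :
  tpt (translate lq sigma (steps_vec L n) x) = fun i => tpt x i * q ^ steps_vec L n i.
Proof. by apply/funext => i; rewrite /tpt translateE cexpD cexpMz hlq. Qed.

Let region_translate n x : D x -> D (translate lq sigma (steps_vec L n) x).
Proof.
move=> /regionE[h1 h2 h3]; apply/regionE; rewrite tpt_translate.
apply: (@in_region_translate _ q N M L a bs c q0 q1 n 0 (tpt x)) => //.
by split=> *; rewrite expr0 mulr1; [apply: h1|apply: h2|apply: h3].
Qed.

Let exists_region x : exists k : V, D (translate lq sigma k x).
Proof.
have [K hK] := exists_in_region L a bs c q1 (tpt x).
exists (steps_vec L (fun=> K)); apply/regionE; rewrite tpt_translate.
exact: (@in_region_translate _ q N M L a bs c q0 q1 _ K (tpt x)).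
Qed.

Lemma solutions_independent (C : label -> logfun R M) :
  (forall o, pseudo_constant lq (C o)) ->
  (forall x, D x -> \sum_o C o x * solution o x = 0) -> forall o x, C o x = 0.
Proof.
(* The vanishing is claimed at every point, also outside the region; moving [x0] along its orbit
   into the region does not change [C]. *)
move=> hC h0 o0 x0; have [k0 Dx] := exists_region x0.
rewrite -(pseudo_constant_translate sigma k0 x0 (hC o0)).
move: (translate _ _ _ _) Dx => x Dx {x0 k0}.
(* Being constant on the orbit, the pseudo-constants can be put into the coefficients. The index 0
   carries the leading term, where the series coefficient is 1. *)
pose w o (nu : V) := C o x * prefactor o x * (coef o nu * monomial (tpt x) nu).
pose mu (o : label) (nu : V) l := `|weight L l nu|%N.
pose z o l := \prod_i mult o i ^ dir L l i.
have mult0 o i : mult o i != 0 by rewrite multiplierE cexp_neq0.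
have z0 o l : z o l != 0 by apply/prodf_neq0 => i _; exact: expfz_neq0.
have bw o : bounded_sums (w o).
  apply: (@bounded_sums_dom _ _ (fun nu : V => coef o nu * monomial (tpt x) nu) _
    (nm (C o x * prefactor o x))) => [|nu]; last by rewrite /w [leLHS]nmM.
  by apply: (bounded_lattice q0 q1 a0 b0 c0 haa' hcc' hab' hcb') => //; exact/regionE.
suff : w o0 0 = 0.
  move/eqP; rewrite /w lattice_coef0 mul1r !mulf_eq0 (negPf (prefactor_neq0 _ _)) orbF.
  have /negPf -> : monomial (tpt x) 0 != 0.
    by apply/prodf_neq0 => i _; rewrite ffunE expr0z oner_eq0.
  by rewrite orbF => /eqP.
apply: (vanishing_family_leading q1 (mu := mu) z0 (p0 := o0)) => //.
- by move=> l; rewrite /mu /weight big1 // => i _; rewrite ffunE mulr0.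
- move=> o oo0; have [l hl] := active_neq L oo0; exists l => n.
  rewrite /z !direction_valueE //.
  by apply: direction_value_inequiv => //; rewrite eq_sym.
- move=> nu nu0 wnu; have cnu : coef o0 nu != 0.
    by move: wnu; rewrite /w; apply: contraNneq => ->; rewrite mul0r mulr0.
  apply/existsP; apply: contraNT nu0; rewrite negb_exists => /forallP h.
  apply/eqP; apply: (weight_eq0 cnu) => l; apply/eqP.
  by have := h l; rewrite -eqn0Ngt absz_eq0.
pose y n := translate lq sigma (steps_vec L n) x.
pose ms o n := multisum (series_term q L a bs c o (tpt (y n))).
exists (fun p n => C p x * prefactor p x * ms p n) => [p n|n].
  have := has_sumZ (C p x * prefactor p x) (proj2 (expansion p (region_translate n Dx))).
  congr has_sum; apply/funext => nu; rewrite tpt_translate monomialM //; last first.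
    by move=> i; exact: expfz_neq0.
  rewrite steps_vec_monomial // /w -[RHS]mulrA; congr (_ * _); rewrite -[RHS]mulrA.
  (* Off the support the weight may be negative and differ from its absolute value [mu]; the
     coefficient is 0 there. *)
  have [->|cnu] := eqVneq (coef p nu) 0; first by rewrite !mul0r.
  congr (_ * _); congr (_ * _); apply: eq_bigr => l _; congr (_ ^+ _).
  by rewrite /mu -[in LHS](gez0_abs (weight_ge0 l cnu)).
rewrite -[RHS](h0 _ (region_translate n Dx)); apply: eq_bigr => o _.
rewrite solutionE prefactor_translate pseudo_constant_translate //.
rewrite prod_steps_vec // -/(ms o n) -/(z o _).
by ring.
Qed.

End FundamentalSolution.

Definition label_index N M (o : option ('I_N * 'I_M)) : 'I_(1 + N * M) :=
  if o is Some (k, l) then rshift 1 (mxvec_index k l) else lshift (N * M) ord0.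

Lemma label_index_bij N M : bijective (@label_index N M).
Proof.
apply: inj_card_bij; last by rewrite card_option card_prod !card_ord.
have [g gK _] := @curry_mxvec_bij N M.
have {}gK k l : g (@mxvec_index N M k l) = (k, l) by exact: (gK (k, l)).
move=> [[k l]|] [[k' l']|] //= /eqP; rewrite ?eq_lrshift ?eq_rlshift ?eq_rshift //.
by move=> /eqP e; congr Some; rewrite -gK e gK.
Qed.

Lemma uvec_label_index (R : realType) (q : R[i]) N M (alpha : 'I_N -> R[i])
    (beta : 'I_M -> R[i]) (gamma : 'I_N -> R[i]) (a : 'I_N -> R[i])
    (b : 'I_M -> R[i]) (c : 'I_N -> R[i]) L sigma o :
  uvec q alpha beta gamma a b c L sigma (label_index o) 0 =
  solution q L sigma alpha beta gamma a b c o.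
Proof.
rewrite /uvec mxE; case: o => [[k l]|] /=.
  by rewrite row_mxEr mxvecE mxE.
by rewrite row_mxEl mxE.
Qed.

Theorem proposition3p6 (R : realType) (q lq : R[i])
  (hq : 0 < `|q| < 1) (hlq : cexp lq = q)
  (N M L : nat) (hN : (1 <= N)%N) (hM : (1 <= M)%N) (hL : (L <= M)%N)
  (sigma : 'S_M)
  (alpha : 'I_N -> R[i]) (beta : 'I_M -> R[i]) (gamma : 'I_N -> R[i])
  (a : 'I_N -> R[i]) (b : 'I_M -> R[i]) (c : 'I_N -> R[i])
  (ha : forall j, a j = cexp (alpha j * lq))
  (hb : forall i, b i = cexp (beta i * lq))
  (hc : forall j, c j = cexp (gamma j * lq))
  (haa : forall j k : 'I_N, j != k -> ~ qZ q (a j / a k))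
  (hcc : forall j k : 'I_N, j != k -> ~ qZ q (c j / c k))
  (hab : forall (j : 'I_N) (i : nat), (i <= M)%N ->
     ~ qZ q (a j / tailprod (fun i => b (sigma i)) i))
  (hcb : forall (j : 'I_N) (i : nat), (i <= M)%N ->
     ~ qZ q (c j / tailprod (fun i => b (sigma i)) i)) :
  series_converge_on q a b c L sigma (region q a b c L sigma)
  /\ fundamental_solution_on lq q a b c (region q a b c L sigma)
       (uvec q alpha beta gamma a b c L sigma).
Proof.
have [idx' idxK Kidx] := @label_index_bij N M.
split; first exact: (series_converge hq hL ha hb hc haa hcc hab hcb).
split=> [p|C hC h0 p].
  rewrite -(Kidx p) uvec_label_index.
  exact: (solution_solves hq hlq hL ha hb hc haa hcc hab hcb).
rewrite -(Kidx p); move: (idx' p).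
apply: (solutions_independent hq hlq hL ha hb hc haa hcc hab hcb
  (C := fun o => C (label_index o))) => [? |x /h0]; first exact: hC.
rewrite (reindex (@label_index N M)) /=; last first.
  by exists idx' => o _; [exact: idxK|exact: Kidx].
by under eq_bigr do rewrite uvec_label_index.
Qed.
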